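(* There exists a function $$l\in\Big(\bigcap_{\alpha\in[0,1)}C^{0,\alpha}(\mathbb{R})\Big)\cap C^\infty(\mathbb{R}\setminus\{0\})$$ with $$\frac12\le l(t)\le\frac32\qquad\text{for all }t\in\mathbb{R},$$ and such that for every $\varepsilon>0$ there is a constant $C_\varepsilon$ with $$|l'(t)|\le C_\varepsilon|t|^{-(1+\varepsilon)}\qquad\text{for all }t\in\mathbb{R}\setminus\{0\},$$ and there exist $u,\ b_1,\ b_2,\ c\in C^\infty_b(\mathbb{R}_t\times\mathbb{R}^2_x)$, with $$\mathrm{Supp}\,u=\{(t,x)\in\mathbb{R}_t\times\mathbb{R}^2_x\ :\ t\ge0\},$$ such that $$\partial_t u+\partial_{x_1}^2u+l\,\partial_{x_2}^2u+b_1\partial_{x_1}u+b_2\partial_{x_2}u+cu=0\qquad\text{in }\mathbb{R}_t\times\mathbb{R}^2_x.$$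
   Context: $C^{0,\alpha}(\mathbb{R})$ for $\alpha\in(0,1)$ is the space of bounded functions $f$ on $\mathbb{R}$ with $\sup_{0<|t-s|<1}\frac{|f(t)-f(s)|}{|t-s|^\alpha}<+\infty$ (for $\alpha=0$: bounded continuous functions). $C^\infty_b$ denotes the space of $C^\infty$ functions that are bounded together with all their derivatives. $l=l(t)$ depends on $t$ only, and $x=(x_1,x_2)$. *)

(* Defs.v *)
From mathcomp Require Import all_boot all_order all_algebra.
From mathcomp Require Import all_classical all_reals all_analysis.

Set Implicit Arguments.
Unset Strict Implicit.
Unset Printing Implicit Defensive.

Import Order.TTheory GRing.Theory Num.Theory.
Import numFieldNormedType.Exports.

Local Open Scope classical_set_scope.
Local Open Scope ring_scope.

Definition C0_alpha (R : realType) (alpha : R) (f : R -> R) : Prop :=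
  [bounded f t | t in [set: R]] /\
  if alpha == 0 then continuous f
  else has_ubound [set q | exists t s : R,
         0 < `|t - s| < 1 /\ q = `|f t - f s| / `|t - s| `^ alpha].

(* For open D; continuity of each derivative on D follows from derivability. *)
Definition smooth_on (R : realType) (D : set R) (f : R -> R) : Prop :=
  forall (n : nat) (t : R), D t -> derivable (derive1n n f) t 1.

(* Points of R_t x R^2_x are written (t, (x1, x2)). *)
Definition et (R : realType) : R * (R * R) := (1, (0, 0)).
Definition ex1 (R : realType) : R * (R * R) := (0, (1, 0)).
Definition ex2 (R : realType) : R * (R * R) := (0, (0, 1)).

Definition axis (R : realType) (i : 'I_3) : R * (R * R) :=
  nth 0 [:: et R; ex1 R; ex2 R] i.

(* partials [:: i1; ...; ik] f = d_i1 (... (d_ik f)) *)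
Definition partials (R : realType) (s : seq 'I_3) (f : R * (R * R) -> R) :
    R * (R * R) -> R :=
  foldr (fun i g => 'D_(axis R i) g) f s.

Definition Cb_infty (R : realType) (f : R * (R * R) -> R) : Prop :=
  forall s : seq 'I_3,
    [/\ forall (i : 'I_3) p, derivable (partials s f) p (axis R i),
        continuous (partials s f)
      & [bounded partials s f p | p in [set: R * (R * R)]]].

Definition Supp (R : realType) (f : R * (R * R) -> R) : set (R * (R * R)) :=
  closure [set p | f p != 0].

(* Main.v *)
(* Think of t decreasing to 0. In the n-th strip the solution passes from the
   mode exp(k_n^2 t) cos(k_n x1) to the next one, of higher frequency. With l = 1
   the old mode decays more slowly, hence dominates, and cannot be switched off at
   the price of bounded lower order terms. Following Plis, an oscillation of l
   acts on an auxiliary wave cos(k_n x2) of the same frequency. This wave enters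
   with relative size exp(-2p), is raised to exp(2p), which hides the exchange of
   the two modes, and is lowered again before it leaves.

   Every switch produces an error E that is exponentially small with respect to
   the dominant wave. If u = D cos(k x_i) + S with D and S independent of x_i,
   then b_i = gamma sin(k x_i)/k and c = - gamma cos(k x_i) give
   b_i d_i u + c u = - gamma (D + S cos(k x_i)), so that
   gamma = E/(D + S cos(k x_i)), with a denominator close to D, absorbs E.

   With k_n = N^2 and strips ending at a_n = exp(- sqrt(ln N)), N = n + n0, the
   function l oscillates by O(1/N) over lengths a_n/(N sqrt(ln N)), while p grows
   at least linearly in N, so that exp(-p) beats all the powers of N lost in
   derivatives. *)
Require Import Defs.
From mathcomp Require Import all_boot all_order all_algebra.
From mathcomp Require Import all_classical all_reals all_analysis.
From mathcomp Require Import ring lra.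

Import Order.TTheory GRing.Theory Num.Theory.
Import numFieldNormedType.Exports.

Local Open Scope classical_set_scope.
Local Open Scope ring_scope.

Set Implicit Arguments.
Unset Strict Implicit.
Unset Printing Implicit Defensive.

(** * Families of smooth functions of moderate growth *)

(** The powers are dictated by two constraints. Put z_n = k_n^2 and let r_n be the length of the
    n-th strip. The auxiliary wave must gain 4p, with p = (z_(n+1) - z_n) r_n, during a fixed
    fraction of the strip, so l deviates from 1 by a multiple of (z_(n+1) - z_n) / z_n, which is
    O(1/N) for any power k_n of N. With k_n = N, p would be of order N r_n, which tends to 0; k_n =
    N^2 gives order N^3 r_n. As a_n = exp(- sqrt(ln N)) decays more slowly than any power of N, r_n
    is at least c N^-(1+s) for each s > 0, so an oscillation of size 1/N over the length r_n is
    Holder of every exponent below 1. Moreover l' is of order 1 / (N r_n), that is |ln a_n| / a_n,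
    which falls just short of 1 / |t|. The formal obstacle is that infinitely many terms accumulate
    at t = 0, where derivatives of all orders must be controlled. No derivative of high order is
    ever computed: each term is a rapidly decreasing factor times a member of the algebra [tame],
    whose derivatives grow at most polynomially in n, and [glueable_moderate] applies to such
    products. *)

Definition Cb1 (R : realType) (g : R -> R) : Prop :=
  forall j : nat, (forall x, derivable (derive1n j g) x 1) /\
    exists C : R, forall x, `|derive1n j g x| <= C.

Section Families.
Context {R : realType} {V : normedModType R} {I : Type}.
Variable e : I -> V.
Implicit Types (F G : nat -> V -> R) (K : nat -> set V).

(** The directions are indexed by an abstract type so that one theory serves functions of one
    variable ([unit_dir]) and of three ([axis]), where this is convertible with [partials]. *)
Definition iter_derive (s : seq I) (f : V -> R) : V -> R :=
  foldr (fun i g => 'D_(e i) g) f s.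

Definition poly_bounded K F : Prop :=
  exists C m, forall n p, K n p -> `|F n p| <= C * n.+1%:R ^+ m.

Definition poly_growth (c : nat -> R) : Prop :=
  exists C m, forall n, `|c n| <= C * n.+1%:R ^+ m.

(* Uniformity in [p : K n], moderate growth in [n]: for a constant family and
   [K n = setT] this is membership in C^oo_b. *)
Definition moderate K F : Prop :=
  forall s, [/\ forall n i p, derivable (iter_derive s (F n)) p (e i),
                forall n, continuous (iter_derive s (F n))
              & poly_bounded K (fun n => iter_derive s (F n))].

Definition coordinate (pi : V -> R) : Prop :=
  continuous pi /\ forall i, exists c, forall p, is_derive p (e i) pi c.

(* The algebra of families out of which everything is built; it is stable under
   derivation. *)
Inductive tame K : (nat -> V -> R) -> Prop :=
| tame_cst c : poly_growth c -> tame K (fun n _ => c n)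
| tame_lin pi a b : coordinate pi -> poly_growth a ->
    poly_bounded K (fun n p => a n * pi p + b n) -> tame K (fun n p => a n * pi p + b n)
| tame_comp pi g a b : coordinate pi -> poly_growth a -> Cb1 g ->
    tame K (fun n p => g (a n * pi p + b n))
| tame_add F G : tame K F -> tame K G -> tame K (fun n p => F n p + G n p)
| tame_mul F G : tame K F -> tame K G -> tame K (fun n p => F n p * G n p)
| tame_inv F : tame K F -> (forall n p, F n p != 0) ->
    poly_bounded K (fun n p => (F n p)^-1) -> tame K (fun n p => (F n p)^-1)
| tame_exp F : tame K F -> poly_bounded K (fun n p => expR (F n p)) ->
    tame K (fun n p => expR (F n p)).

Lemma poly_bounded_add K F G : poly_bounded K F -> poly_bounded K G ->
  poly_bounded K (fun n p => F n p + G n p).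
Proof.
move=> [C [m hF]] [D [k hG]]; exists (`|C| + `|D|), (m + k)%N => n p Kp.
have n1 : (1 <= n.+1%:R :> R) by rewrite ler1n.
apply: le_trans (ler_normD _ _) _; rewrite mulrDl lerD//.
- apply: le_trans (hF n p Kp) _; apply: le_trans (ler_wpM2r _ (ler_norm C)) _.
    by rewrite exprn_ge0.
  by rewrite ler_wpM2l// ler_weXn2l// leq_addr.
- apply: le_trans (hG n p Kp) _; apply: le_trans (ler_wpM2r _ (ler_norm D)) _.
    by rewrite exprn_ge0.
  by rewrite ler_wpM2l// ler_weXn2l// leq_addl.
Qed.

Lemma poly_bounded_mul K F G : poly_bounded K F -> poly_bounded K G ->
  poly_bounded K (fun n p => F n p * G n p).
Proof.
move=> [C [m hF]] [D [k hG]]; exists (C * D), (m + k)%N => n p Kp.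
by rewrite normrM exprD mulrACA ler_pM// ?hF ?hG.
Qed.

Lemma poly_bounded_bounded K F C : (forall n p, K n p -> `|F n p| <= C) -> poly_bounded K F.
Proof. by move=> h; exists C, 0%N => n p Kp; rewrite expr0 mulr1 h. Qed.

Lemma poly_bounded_cst K c : poly_growth c -> poly_bounded K (fun n _ => c n).
Proof. by move=> [C [m h]]; exists C, m => n p _. Qed.

Lemma poly_growth_const x : poly_growth (fun=> x).
Proof. by exists `|x|, 0%N => n; rewrite expr0 mulr1. Qed.

Lemma poly_growth_mul c d : poly_growth c -> poly_growth d -> poly_growth (fun n => c n * d n).
Proof.
move=> [C [m hF]] [D [k hG]]; exists (C * D), (m + k)%N => n.
by rewrite normrM exprD mulrACA ler_pM// ?hF ?hG.
Qed.

(** Restricting f to the line through p along v reduces this to the chain rule in one variable; only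
    a directional derivative of f is available. *)
Lemma is_derive_comp1 (g : R -> R) (f : V -> R) (p v : V) (dg df : R) :
  is_derive (f p) 1 g dg -> is_derive p v f df ->
  is_derive p v (fun q => g (f q)) (dg * df).
Proof.
move=> hg hf.
have hf' : is_derive (0 : R) 1 (fun h : R => f (h *: v + p)) df.
  split; first by apply: (derivable1P f p v).1; case: hf.
  case: hf => _ <-; rewrite /derive; apply: (congr1 (fun g : R -> R => lim (g @ 0^'))).
  by apply/funext => h /=; rewrite addr0 scale0r add0r [_%:A]mulr1.
have hc : is_derive (0 : R) 1 (g \o (fun h : R => f (h *: v + p))) (dg * df).
  by apply: is_derive1_comp => //; rewrite scale0r add0r.
split; first by apply: (derivable1P (fun q => g (f q)) p v).2; case: hc.
case: hc => _ <-; rewrite /derive; apply: (congr1 (fun g : R -> R => lim (g @ 0^'))).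
by apply/funext => h /=; rewrite addr0 scale0r add0r [_%:A]mulr1.
Qed.

Lemma Cb1_is_derive (g : R -> R) (x : R) : Cb1 g -> is_derive x 1 g ((derive1 g) x).
Proof. by move=> /(_ 0%N)[/(_ x) h _]; rewrite derive1E; exact: derivableP. Qed.

Lemma Cb1_continuous (g : R -> R) : Cb1 g -> continuous g.
Proof.
move=> hg x; apply/differentiable_continuous/derivable1_diffP.
by case: (Cb1_is_derive x hg).
Qed.

Lemma Cb1_derive1 (g : R -> R) : Cb1 g -> Cb1 (derive1 g).
Proof. by move=> hg j; rewrite -derive1Sn; exact: (hg j.+1). Qed.

Lemma is_derive_lin (pi : V -> R) (a b c : R) i p : is_derive p (e i) pi c ->
  is_derive p (e i) (fun q => a * pi q + b) (a * c).
Proof.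
move=> h.
have h1 := is_deriveD (is_deriveZ a h) (is_derive_cst b p (e i)).
by apply: is_derive_eq (h1) _; rewrite addr0.
Qed.

Lemma tame_step K F : tame K F ->
  [/\ forall n i p, derivable (F n) p (e i), forall n, continuous (F n),
      poly_bounded K F & forall i, tame K (fun n => 'D_(e i) (F n))].
Proof.
(* The induction carries an explicit family G for each derivative: membership in [tame] is about
   formulas, whereas the derivative itself is a limit. *)
suff main : tame K F -> [/\ forall n, continuous (F n), poly_bounded K F &
    forall i, exists2 G, tame K G & forall n p, is_derive p (e i) (F n) (G n p)].
  move=> /main[h1 h2 h3]; split => //.
    by move=> n i p; have [G _ /(_ n p)[]] := h3 i.
  move=> i; have [G hG h] := h3 i.
  suff -> : (fun n => 'D_(e i) (F n)) = G by [].
  by apply/funext => n; apply/funext => p; have [_] := h n p.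
elim=> {F}.
- move=> c hc; split; [by move=> n p; exact: cvg_cst|exact: poly_bounded_cst|].
  move=> i; exists (fun _ _ => 0); first exact: tame_cst (poly_growth_const 0).
  by move=> n p; exact: is_derive_cst.
- move=> pi a b [cpi dpi] ha hb; split => //.
    move=> n p; apply: cvgD; last exact: cvg_cst.
    by apply: cvgM; [exact: cvg_cst|exact: cpi].
  move=> i; have [c hc] := dpi i.
  exists (fun n _ => a n * c).
    apply: (@tame_cst K (fun n => a n * c)); apply: poly_growth_mul => //.
    exact: poly_growth_const.
  by move=> n p; exact: is_derive_lin.
- move=> pi g a b [cpi dpi] ha hg; split.
  + move=> n p; apply: (@continuous_comp _ _ _ (fun p => a n * pi p + b n) g).
      apply: cvgD; last exact: cvg_cst.
      by apply: cvgM; [exact: cvg_cst|exact: cpi].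
    exact: Cb1_continuous.
  + have [_ [C hC]] := hg 0%N.
    by apply: (@poly_bounded_bounded _ _ C) => n p _; exact: hC.
  + move=> i; have [c hc] := dpi i.
    exists (fun n p => (a n * c) * (derive1 g) (a n * pi p + b n)).
      apply: (@tame_mul K (fun n p => a n * c)).
        apply: (@tame_cst K (fun n => a n * c)); apply: poly_growth_mul => //.
        exact: poly_growth_const.
      by apply: tame_comp => //; exact: Cb1_derive1.
    move=> n p; rewrite mulrC.
    apply: (@is_derive_comp1 g (fun p => a n * pi p + b n)); first exact: Cb1_is_derive.
    exact: is_derive_lin.
- move=> F G aF [cF bF dF] aG [cG bG dG]; split.
  + by move=> n p; apply: cvgD; [exact: cF|exact: cG].
  + exact: poly_bounded_add.
  + move=> i; have [F' aF' hF'] := dF i; have [G' aG' hG'] := dG i.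
    exists (fun n p => F' n p + G' n p); first exact: tame_add.
    by move=> n p; exact: (is_deriveD (hF' n p) (hG' n p)).
- move=> F G aF [cF bF dF] aG [cG bG dG]; split.
  + by move=> n p; apply: cvgM; [exact: cF|exact: cG].
  + exact: poly_bounded_mul.
  + move=> i; have [F' aF' hF'] := dF i; have [G' aG' hG'] := dG i.
    exists (fun n p => F n p * G' n p + G n p * F' n p).
      by apply: tame_add; exact: tame_mul.
    by move=> n p; exact: (is_deriveM (hF' n p) (hG' n p)).
- move=> F aF [cF bF dF] nz bi; split => //.
  + by move=> n p; apply: cvgV => //; exact: cF.
  + move=> i; have [F' aF' hF'] := dF i.
    exists (fun n p => (-1) * ((F n p)^-1 * (F n p)^-1) * F' n p).
      apply: tame_mul => //; apply: tame_mul; first exact: (tame_cst K (poly_growth_const (-1))).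
      by apply: tame_mul; exact: tame_inv.
    move=> n p; have [dFp eF] := hF' n p.
    split; first by apply: derivableV.
    by rewrite deriveV// eF mulN1r -invfM -expr2.
- move=> F aF [cF bF dF] be; split => //.
  + move=> n p; apply: (@continuous_comp _ _ _ (F n) expR); first exact: cF.
    exact: continuous_expR.
  + move=> i; have [F' aF' hF'] := dF i.
    exists (fun n p => expR (F n p) * F' n p).
      by apply: tame_mul => //; exact: tame_exp.
    by move=> n p; exact: is_derive_comp1.
Qed.

Lemma tame_moderate K F : tame K F -> moderate K F.
Proof.
move=> aF s.
suff h : tame K (fun n => iter_derive s (F n)) by have [? ? ? _] := tame_step h; split.
by elim: s => [//|i s ih] /=; have [_ _ _ /(_ i)] := tame_step ih.
Qed.

Lemma tame_ext K F G : tame K F -> (forall n p, F n p = G n p) -> tame K G.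
Proof.
move=> aF FG; suff <- : F = G by [].
by apply/funext => n; apply/funext => p.
Qed.

Lemma tame_neg K F : tame K F -> tame K (fun n p => - F n p).
Proof.
move=> h; have -> : (fun n p => - F n p) = (fun n p => -1 * F n p).
  by apply/funext => n; apply/funext => p; rewrite mulN1r.
by apply: (@tame_mul K (fun _ _ => -1)) => //; exact: (tame_cst K (poly_growth_const (-1))).
Qed.

Lemma tame_sub K F G : tame K F -> tame K G -> tame K (fun n p => F n p - G n p).
Proof. by move=> hF hG; apply: tame_add => //; exact: tame_neg. Qed.

Lemma tame_const K x : tame K (fun _ _ => x).
Proof. exact: (tame_cst K (poly_growth_const x)). Qed.

Lemma iter_derive_add (f g : V -> R) s :
  (forall s i p, derivable (iter_derive s f) p (e i)) ->
  (forall s i p, derivable (iter_derive s g) p (e i)) ->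
  iter_derive s (fun p => f p + g p) = (fun p => iter_derive s f p + iter_derive s g p).
Proof.
move=> hf hg; elim: s => [//|i s ih] /=; rewrite ih; apply/funext => p.
exact: (deriveD (hf s i p) (hg s i p)).
Qed.

(** Needed besides [tame_add] because a glued sum is only known to be [moderate]; see [Cb_cc]. *)
Lemma moderate_add K F G : moderate K F -> moderate K G ->
  moderate K (fun n p => F n p + G n p).
Proof.
move=> hF hG s; have [dF cF bF] := hF s; have [dG cG bG] := hG s.
have -> : (fun n => iter_derive s (fun p => F n p + G n p)) =
    (fun n p => iter_derive s (F n) p + iter_derive s (G n) p).
  apply/funext => n; apply: iter_derive_add => s' i p.
    by have [h _ _] := hF s'; exact: h.
  by have [h _ _] := hG s'; exact: h.
split.
- move=> n i p; rewrite (@iter_derive_add (F n) (G n)).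
  + exact: (derivableD (dF n i p) (dG n i p)).
  + by move=> s' j q; have [h _ _] := hF s'; exact: h.
  + by move=> s' j q; have [h _ _] := hG s'; exact: h.
- move=> n p; rewrite (@iter_derive_add (F n) (G n)).
  + by apply: cvgD; [exact: cF|exact: cG].
  + by move=> s' j q; have [h _ _] := hF s'; exact: h.
  + by move=> s' j q; have [h _ _] := hG s'; exact: h.
- exact: poly_bounded_add.
Qed.

Lemma derive_zero_near (f : V -> R) p v :
  (\forall q \near p, f q = 0) -> 'D_v f p = 0.
Proof.
move=> h; rewrite (@near_eq_derive _ _ _ f (cst 0)) ?derive_cst//.
Qed.

Lemma iter_derive_zero (f : V -> R) (U : set V) s : open U ->
  (forall p, U p -> f p = 0) -> forall p, U p -> iter_derive s f p = 0.
Proof.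
move=> oU h; elim: s => [//|i s ih] p Up /=; apply: derive_zero_near.
by apply: filterS (open_nbhs_nbhs (conj oU Up)) => q; exact: ih.
Qed.

End Families.

(** * A smooth step function *)

Section Flat.
Context {R : realType}.
Implicit Types (P : {poly R}) (x y : R).

(** Taking h = 0 gives f p = 0, and the difference quotient is then at most C |h|. This settles the
    two flat points of the development: the origin for [flat], and time 0 for glued sums. *)
Lemma is_derive0_quadratic (V : normedModType R) (f : V -> R) (p v : V) (C : R) :
  (forall h : R, `|f (h *: v + p)| <= C * h ^+ 2) -> is_derive p v f 0.
Proof.
move=> hf.
have fp0 : f p = 0.
  have := hf 0; rewrite scale0r add0r expr0n mulr0 => h.
  by apply/eqP; rewrite -normr_le0.
suff h : (fun h : R => h^-1 *: ((f \o shift p) (h *: v) - f p)) @ 0^' --> (0 : R).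
  split; first by apply/cvg_ex; exists 0; exact: h.
  by rewrite /derive; apply: cvg_lim h.
have C1 : 0 < `|C| + 1 by rewrite ltr_wpDl.
rewrite fp0; apply/cvgrPdist_le => eps eps0; near=> h.
rewrite sub0r normrN /= subr0 normrM normfV.
have h0 : 0 < `|h| by rewrite normr_gt0; near: h; exact: nbhs_dnbhs_neq.
rewrite ler_pdivrMl//; apply: le_trans (hf h) _.
rewrite -real_normK ?num_real// expr2 mulrCA ler_pM2l//.
have hle : `|h| <= eps / (`|C| + 1).
  near: h; apply: nbhs_dnbhs; apply: filterS (nbhs0_le (divr_gt0 eps0 C1)) => //.
apply: le_trans (ler_wpM2r (normr_ge0 _) (ler_norm C)) _.
move: hle; rewrite ler_pdivlMr// mulrC; apply: le_trans.
by rewrite ler_wpM2r// lerDl.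
Unshelve. all: by end_near. Qed.

Lemma expr_le_fact_exp (m : nat) y : 0 <= y -> y ^+ m <= m`!%:R * expR y.
Proof.
move=> y0; case: m => [|m]; first by rewrite expr0 fact0 mul1r -expR0 ler_expR.
rewrite mulrC -ler_pdivrMr ?ltr0n ?fact_gt0//.
by apply: le_trans (expR_ge1Dxn m y0); rewrite lerDr.
Qed.

Lemma poly_exp_bound P : exists C, forall y, 0 <= y -> `|P.[y]| * expR (- y) <= C.
Proof.
exists (\sum_(i < size P) `|P`_i| * i`!%:R) => y y0.
rewrite horner_coef expRN ler_pdivrMr ?expR_gt0// mulr_suml.
apply: le_trans (ler_norm_sum _ _ _) _; apply: ler_sum => i _.
rewrite normrM -mulrA ler_wpM2l// ger0_norm ?exprn_ge0//.
exact: expr_le_fact_exp.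
Qed.

(** The classical exp(-1/x), with a polynomial in 1/x in front so that the family is stable under
    derivation. *)
Definition flat P x : R := if 0 < x then P.[x^-1] * expR (- x^-1) else 0.

Lemma flat_le0 P x : x <= 0 -> flat P x = 0.
Proof. by move=> x0; rewrite /flat ltNge x0. Qed.

Lemma flat_gt0E P x : 0 < x -> flat P x = P.[x^-1] * expR (- x^-1).
Proof. by move=> x0; rewrite /flat x0. Qed.

Lemma flat_bound P : exists C, forall x, `|flat P x| <= C.
Proof.
have [C hC] := poly_exp_bound P; exists (Num.max C 0) => x.
rewrite /flat; case: ifPn => [x0|_]; last by rewrite normr0 le_max lexx orbT.
rewrite normrM [`|expR _|]ger0_norm ?expR_ge0// le_max hC// ltW//.
by rewrite invr_gt0.
Qed.

(** For x > 0, [flat P x] divided by x^2 is [flat ('X^2 * P) x], which is bounded. *)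
Lemma flat_quadratic P : exists C, forall x, `|flat P x| <= C * x ^+ 2.
Proof.
have [C hC] := flat_bound ('X^2 * P); exists C => x.
have := hC x; rewrite /flat; case: ifPn => [x0|_ h]; last first.
  by rewrite normr0 mulr_ge0 ?sqr_ge0// -(normr0 R).
rewrite hornerM hornerXn -mulrA normrM => h.
have x20 : 0 < x ^+ 2 by rewrite exprn_gt0.
rewrite -ler_pdivrMr// mulrC; apply: le_trans h.
by rewrite normrX normfV exprVn [`|x|]gtr0_norm.
Qed.

Definition flatD P : {poly R} := 'X^2 * (P - P^`()).

Lemma is_derive_flat P x : is_derive x 1 (flat P) (flat (flatD P) x).
Proof.
have [x0|x0|->] := ltgtP x 0.
- rewrite (flat_le0 (flatD P)); last exact: ltW.
  apply: (@near_eq_is_derive _ _ _ (cst 0)).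
  by near=> y; rewrite flat_le0//; apply/ltW; near: y; exact: lt_nbhsl.
- rewrite (flat_gt0E (flatD P) x0).
  apply: (@near_eq_is_derive _ _ _ (fun y => P.[y^-1] * expR (- y^-1))).
    by near=> y; rewrite flat_gt0E//; near: y; exact: lt_nbhsr.
  have dV : is_derive x 1 (fun y : R => y^-1) (- x ^- 2).
    split; first by apply: derivableV => //; rewrite gt_eqF.
    by rewrite (@deriveV _ _ id) ?gt_eqF//= derive_id [_ *: _]mulr1.
  have dP : is_derive x 1 (fun y : R => P.[y^-1]) (P^`().[x^-1] * - x ^- 2).
    have dH : is_derive x^-1 1 (horner P) (P^`().[x^-1]).
      have E : P^`().[x^-1] = 'D_1 (horner P) x^-1 by rewrite -derive1E -derivE.
      by rewrite E; apply: derivableP; exact: derivable_horner.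
    exact: (is_derive_comp1 dH dV).
  have dN : is_derive x 1 (fun y : R => - y^-1) (x ^- 2).
    by have := is_deriveN dV; rewrite opprK.
  have dE : is_derive x 1 (fun y : R => expR (- y^-1)) (expR (- x^-1) * x ^- 2).
    exact: (@is_derive_comp1 R R expR (fun y : R => - y^-1) x 1 _ _ (is_derive_expR _) dN).
  apply: is_derive_eq (is_deriveM dP dE) _.
  rewrite /flatD hornerM hornerXn hornerD hornerN exprVn ![_ *: _]/GRing.scale /=.
  by set E := expR _; set X := x ^- 2; ring.
- rewrite (flat_le0 (flatD P)) //; have [C hC] := flat_quadratic P.
  by apply: (@is_derive0_quadratic _ _ _ _ C) => h; rewrite addr0 [_%:A]mulr1.
Unshelve. all: by end_near. Qed.

Lemma flat_Cb1 P : Cb1 (flat P).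
Proof.
move=> j.
have -> : derive1n j (flat P) = flat (iter j flatD P).
  elim: j => [//|j ih]; rewrite derive1nS ih; apply/funext => x.
  by rewrite derive1E; have [_ ->] := is_derive_flat (iter j flatD P) x.
by split; [move=> x; case: (is_derive_flat (iter j flatD P) x)|exact: flat_bound].
Qed.

Definition bump0 : R -> R := flat 1.

Lemma bump0_le0 x : x <= 0 -> bump0 x = 0.
Proof. by move=> x0; rewrite /bump0 /flat ltNge x0. Qed.

Lemma bump0_gt0 x : 0 < x -> 0 < bump0 x.
Proof. by move=> x0; rewrite /bump0 /flat x0 hornerC mul1r expR_gt0. Qed.

Lemma bump0_ge0 x : 0 <= bump0 x.
Proof.
by have [/bump0_le0->|/bump0_gt0/ltW] := leP x 0.
Qed.

Lemma bump0_incr x y : x <= y -> bump0 x <= bump0 y.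
Proof.
have [x0 _|x0 xy] := leP x 0; first by rewrite (bump0_le0 x0) bump0_ge0.
have y0 := lt_le_trans x0 xy.
by rewrite /bump0 /flat x0 y0 !hornerC !mul1r ler_expR lerN2 lef_pV2.
Qed.

Definition bumps x : R := bump0 x + bump0 (1 - x).

(** One of x and 1 - x is at least 1/2. A bound uniform in x is what allows the quotient [step] to
    have bounded derivatives. *)
Lemma bumps_ge x : bump0 (1 / 2) <= bumps x.
Proof.
have [h|h] := leP x (1 / 2).
  by rewrite ler_wpDl ?bump0_ge0// bump0_incr//; lra.
by rewrite ler_wpDr ?bump0_ge0// bump0_incr// ltW.
Qed.

Lemma bumps_gt0 x : 0 < bumps x.
Proof. by apply: lt_le_trans (bumps_ge x); apply: bump0_gt0; lra. Qed.

Definition step x : R := bump0 x / bumps x.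

Lemma step_le0 x : x <= 0 -> step x = 0.
Proof. by move=> x0; rewrite /step bump0_le0// mul0r. Qed.

Lemma step_ge1 x : 1 <= x -> step x = 1.
Proof.
move=> x1; rewrite /step /bumps [bump0 (1 - x)]bump0_le0 ?subr_le0// addr0 divff//.
by rewrite gt_eqF// bump0_gt0//; lra.
Qed.

Lemma step_gt0 x : 0 < x -> 0 < step x.
Proof. by move=> x0; rewrite divr_gt0 ?bumps_gt0 ?bump0_gt0. Qed.

Lemma step_lt1 x : x < 1 -> step x < 1.
Proof.
by move=> x1; rewrite ltr_pdivrMr ?bumps_gt0// mul1r ltrDl bump0_gt0 ?subr_gt0.
Qed.

Lemma step_ge0 x : 0 <= step x.
Proof. by rewrite divr_ge0 ?bump0_ge0// ltW// bumps_gt0. Qed.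

Lemma step_le1 x : step x <= 1.
Proof.
by rewrite ler_pdivrMr ?bumps_gt0// mul1r lerDl bump0_ge0.
Qed.

End Flat.

Section OneDim.
Context {R : realType}.
Definition unit_dir : unit -> R := fun=> 1.

Lemma coordinate_id : coordinate unit_dir (id : R -> R).
Proof.
split; first by move=> x; exact: cvg_id.
by move=> i; exists 1 => p; exact: is_derive_id.
Qed.

Lemma iter_derive_unit_dir (f : R -> R) s : iter_derive unit_dir s f = derive1n (size s) f.
Proof.
elim: s => [//|i s ih].
have -> : derive1n (size (i :: s)) f = derive1 (derive1n (size s) f) by [].
by apply/funext => x; rewrite derive1E -ih.
Qed.

(** [moderate] bounds derivatives on K only; off K the function vanishes on an open set, hence so do
    all its derivatives. *)
Lemma Cb1_moderate (K : set R) (f : R -> R) : moderate unit_dir (fun=> K) (fun=> f) ->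
  open (~` K) -> (forall x, ~ K x -> f x = 0) -> Cb1 f.
Proof.
move=> h oK fK j.
have := h (nseq j tt); rewrite iter_derive_unit_dir size_nseq => -[d c [C [m b]]].
split; first by move=> x; exact: d 0%N tt x.
exists `|C| => x; have [Kx|Kx] := pselect (K x).
  by have := b 0%N x Kx; rewrite expr1n mulr1 => /le_trans; apply; exact: ler_norm.
have := @iter_derive_zero _ _ _ unit_dir f _ (nseq j tt) oK fK x Kx.
by rewrite iter_derive_unit_dir size_nseq => ->; rewrite normr0.
Qed.

Lemma step_Cb1 : Cb1 (@step R).
Proof.
apply: (@Cb1_moderate setT); last 2 first.
- by rewrite setCT; exact: open0.
- by move=> x /(_ Logic.I).
apply: tame_moderate.
have growth_const (x : R) : poly_growth (fun=> x) by exact: poly_growth_const.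
have a0 : tame unit_dir (fun=> setT) (fun _ => @bump0 R).
  have h := tame_comp (fun=> setT) (fun=> 0) coordinate_id (growth_const 1)
    (flat_Cb1 (1 : {poly R})).
  by apply: tame_ext h _ => n p; rewrite mul1r addr0.
have a1 : tame unit_dir (fun=> setT) (fun _ x => @bump0 R (1 - x)).
  have h := tame_comp (fun=> setT) (fun=> 1) coordinate_id (growth_const (-1))
    (flat_Cb1 (1 : {poly R})).
  by apply: tame_ext h _ => n p; rewrite mulN1r addrC.
apply: tame_mul => //; apply: tame_inv.
- exact: tame_add.
- by move=> _ p; rewrite gt_eqF// bumps_gt0.
- apply: (@poly_bounded_bounded _ _ _ _ (bump0 (1/2))^-1) => _ p _.
  have h := @bumps_gt0 R p.
  rewrite ger0_norm ?invr_ge0 ?(ltW h)// lef_pV2 ?posrE// ?bumps_ge//.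
  by apply: bump0_gt0; lra.
Qed.

End OneDim.

(** * Gluing *)

(** An infinite sum written as a limit. It is evaluated only at points where all but finitely many
    terms vanish, through [glue_eq]. *)
Definition glue (R : realType) (T : Type) (F : nat -> T -> R) (p : T) : R :=
  lim ((\sum_(i < n) F i p) @[n --> \oo]).

Lemma glue_eq (R : realType) (T : Type) (F : nat -> T -> R) (p : T) (M : nat) :
  (forall n, (M <= n)%N -> F n p = 0) -> glue F p = \sum_(i < M) F i p.
Proof.
move=> h; apply: lim_near_cst => //; exists M => // n /= Mn.
rewrite -!(big_mkord xpredT (fun i => F i p)) (big_cat_nat _ Mn)//=.
rewrite [X in _ + X]big_nat_cond [X in _ + X]big1 ?addr0// => i.
by rewrite andbT => /andP[/h].
Qed.

(** Summable by telescoping, with an inverse of polynomial growth that rapid decay can absorb. *)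
Definition weight (R : realType) (n : nat) : R := (n.+1%:R * n.+2%:R)^-1.

Lemma weight_ge0 (R : realType) n : 0 <= weight R n.
Proof. by rewrite invr_ge0 mulr_ge0. Qed.

Lemma sum_weight (R : realType) M : \sum_(i < M) weight R i <= 1.
Proof.
have -> : \sum_(i < M) weight R i = 1 - M.+1%:R^-1.
  elim: M => [|M ih]; first by rewrite big_ord0 invr1 subrr.
  rewrite big_ord_recr /= ih /weight.
  have h1 : M%:R + 1 != 0 :> R by rewrite natr1 pnatr_eq0.
  have h2 : M%:R + 2 != 0 :> R by rewrite -natrD addn2 pnatr_eq0.
  rewrite -[M.+2]addn2 -[M.+1]addn1 !natrD.
  by field; rewrite h1 h2.
by rewrite gerBl invr_ge0.
Qed.

Section Glue.
Context {R : realType} {V : normedModType R} {I : Type}.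
Variables (e : I -> V) (tau : V -> R).
Hypothesis tauc : continuous tau.
Hypothesis taue : forall i p (h : R), `|tau (h *: e i + p) - tau p| <= `|h|.
(** An upper bound for [tau] on the support of the n-th term. In [glueable] the index 0 is exempt,
    as the first mode lives for all large times. *)
Variable b : nat -> R.
Hypothesis b0 : forall eps, 0 < eps -> exists M, forall n, (M <= n)%N -> b n < eps.

Implicit Types (F G : nat -> V -> R) (p : V).

(** With the positive part, the quadratic bound in [glueable] also says that every term vanishes
    where [tau] is at most 0. *)
Let tp p := Num.max 0 (tau p).

(* The quadratic bound makes [glue F] flat at [tau = 0], where infinitely many
   terms accumulate. *)
Definition glueable (F : nat -> V -> R) : Prop :=
  [/\ forall s n i p, derivable (iter_derive e s (F n)) p (e i),
      forall s n, continuous (iter_derive e s (F n)),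
      forall n p, (0 < n)%N -> b n < tau p -> F n p = 0
    & forall s, exists C, forall n p, `|iter_derive e s (F n) p| <= C * weight R n /\
        `|iter_derive e s (F n) p| <= C * weight R n * tp p ^+ 2].

Lemma tp_le0 p : tau p <= 0 -> tp p = 0.
Proof. by move=> h; rewrite /tp max_l. Qed.

Lemma iter_derive_rcons s i (f : V -> R) :
  iter_derive e (rcons s i) f = iter_derive e s ('D_(e i) f).
Proof. by rewrite /iter_derive foldr_rcons. Qed.

Lemma glueable_derive F i : glueable F -> glueable (fun n => 'D_(e i) (F n)).
Proof.
move=> [h1 h2 h3 h4]; split.
- by move=> s n j p; rewrite -iter_derive_rcons.
- by move=> s n; rewrite -iter_derive_rcons.
- move=> n p n0 bp; apply: (@iter_derive_zero _ _ _ e (F n) [set q | b n < tau q] [:: i]) => //.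
    have h : {in tau @^-1` [set x | b n < x], continuous tau} by move=> x _; exact: tauc.
    exact: (open_comp h (@open_gt R (b n))).
  by move=> q; exact: h3.
- by move=> s; have [C hC] := h4 (rcons s i); exists C => n p; rewrite -iter_derive_rcons.
Qed.

Lemma glueable_pd F s : glueable F -> glueable (fun n => iter_derive e s (F n)).
Proof.
move=> gF; elim: s => [//|i s ih] /=; exact: glueable_derive.
Qed.

Lemma glueable_le0 F : glueable F -> forall n p, tau p <= 0 -> F n p = 0.
Proof.
move=> [_ _ _ h] n p tp0; have [C hC] := h [::]; have [_] := hC n p.
by rewrite tp_le0// expr0n mulr0 normr_le0 => /eqP.
Qed.

Lemma glueable_stable F p : glueable F -> exists M, forall n, (M <= n)%N -> F n p = 0.
Proof.
move=> gF; have [h|h] := leP (tau p) 0.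
  by exists 0%N => n _; rewrite (glueable_le0 gF).
have [M hM] := b0 h; exists M.+1 => n Mn; have [_ _ -> //] := gF.
  by exact: leq_trans Mn.
by apply: hM; exact: ltnW.
Qed.

Lemma glueable_near F p : glueable F -> tau p != 0 ->
  exists M, \forall q \near p, forall n, (M <= n)%N -> F n q = 0.
Proof.
move=> gF; rewrite neq_lt => /orP[h|h].
  exists 0%N; have hq : \forall q \near p, tau q < 0 := @tauc p _ (lt_nbhsl h).
  by apply: filterS hq => q /ltW ? n _; rewrite (glueable_le0 gF).
have h2 : tau p / 2 < tau p by rewrite ltr_pdivrMr// ltr_pMr// ltr1n.
have [M hM] := b0 (divr_gt0 h (ltr0n _ 2)).
exists M.+1; have hq : \forall q \near p, tau p / 2 < tau q := @tauc p _ (lt_nbhsr h2).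
apply: filterS hq => q hq n Mn; have [_ _ -> //] := gF.
  by exact: leq_trans Mn.
by apply: lt_trans hq; apply: hM; exact: ltnW.
Qed.

Lemma glue_le0 F p : glueable F -> tau p <= 0 -> glue F p = 0.
Proof.
move=> gF h; rewrite (@glue_eq _ _ _ _ 0%N) ?big_ord0// => n _.
exact: glueable_le0.
Qed.

Lemma glue_bound F : glueable F ->
  exists C, forall p, `|glue F p| <= C /\ `|glue F p| <= C * tp p ^+ 2.
Proof.
move=> gF; have [_ _ _ /(_ [::])[C hC]] := gF; exists (Num.max C 0) => p.
have C0 : 0 <= Num.max C 0 by rewrite le_max lexx orbT.
have CC : C <= Num.max C 0 by rewrite le_max lexx.
have [M hM] := glueable_stable p gF; rewrite (glue_eq hM); split.
- apply: le_trans (ler_norm_sum _ _ _) _.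
  apply: (@le_trans _ _ (\sum_(i < M) Num.max C 0 * weight R i)).
    apply: ler_sum => i _; have [h _] := hC i p; apply: le_trans h _.
    by rewrite ler_wpM2r// weight_ge0.
  by rewrite -mulr_sumr ler_piMr// sum_weight.
- apply: le_trans (ler_norm_sum _ _ _) _.
  apply: (@le_trans _ _ (\sum_(i < M) (Num.max C 0 * tp p ^+ 2) * weight R i)).
    apply: ler_sum => i _; have [_ h] := hC i p; apply: le_trans h _.
    by rewrite mulrAC ler_wpM2r ?weight_ge0// ler_wpM2r// sqr_ge0.
  by rewrite -mulr_sumr ler_piMr ?sum_weight// mulr_ge0 ?sqr_ge0.
Qed.

Lemma glue_near F p M : (\forall q \near p, forall n, (M <= n)%N -> F n q = 0) ->
  \forall q \near p, glue F q = \sum_(i < M) F i q.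
Proof. by apply: filterS => q h; exact: glue_eq. Qed.

(** Where [tau] is nonzero the sum is locally finite. Where [tau] is 0, both sides vanish: [tau]
    changes by at most |h| along the direction, so the glued function is at most C h^2 there. *)
Lemma glue_is_derive F i p : glueable F ->
  is_derive p (e i) (glue F) (glue (fun n => 'D_(e i) (F n)) p).
Proof.
move=> gF; have gD := glueable_derive i gF.
have [h|h] := eqVneq (tau p) 0.
  rewrite (glue_le0 gD) ?h//; have [C hC] := glue_bound gF.
  apply: (@is_derive0_quadratic _ _ _ _ _ C) => x.
  have [C0 hCx] := hC (x *: e i + p); apply: le_trans hCx _.
  have {}C0 : 0 <= C by apply: le_trans C0.
  rewrite ler_wpM2l// -[leRHS]real_normK ?num_real//.
  rewrite lerXn2r// ?nnegrE// ?le_max ?lexx//.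
  rewrite ge_max normr_ge0 /=.
  by have := taue i p x; rewrite h subr0; apply: le_trans; exact: ler_norm.
have [M1 h1] := glueable_near gF h; have [M2 h2] := glueable_near gD h.
pose M := maxn M1 M2.
have hM1 : \forall q \near p, forall n, (M <= n)%N -> F n q = 0.
  by apply: filterS h1 => q hq n Mn; apply: hq; apply: leq_trans Mn; exact: leq_maxl.
have hM2 : forall n, (M <= n)%N -> 'D_(e i) (F n) p = 0.
  move=> n Mn; apply: (nbhs_singleton h2); apply: leq_trans Mn; exact: leq_maxr.
rewrite (glue_eq hM2).
apply: (@near_eq_is_derive _ _ _ (\sum_(j < M) F j)).
  apply: filterS (glue_near hM1) => q ->; by rewrite fct_sumE.
have [d _ _ _] := gF.
split; first by apply: derivable_sum => j; exact: (d [::] j i p).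
by rewrite derive_sum// => j; exact: (d [::] j i p).
Qed.

Lemma glue_continuous F : glueable F -> continuous (glue F).
Proof.
move=> gF p; have [h|h] := eqVneq (tau p) 0.
  have [C hC] := glue_bound gF.
  have C0 : 0 <= C by have [+ _] := hC p; exact: le_trans.
  rewrite /continuous_at (glue_le0 gF) ?h//.
  have cC : (C * tau q ^+ 2) @[q --> p] --> (0 : R).
    have -> : 0 = C * (tau p ^+ 2) by rewrite h expr0n mulr0.
    by apply: cvgM; [exact: cvg_cst|apply: cvgM; exact: tauc].
  apply: norm_cvg0; apply: (squeeze_cvgr _ (cvg_cst 0) cC).
  near=> q; rewrite normr_ge0 /=; have [_ hq] := hC q; apply: le_trans hq _.
  rewrite ler_wpM2l// /tp; have [t0|t0] := leP (tau q) 0; last by [].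
  by rewrite expr0n sqr_ge0.
have [M hM] := glueable_near gF h.
have E : \sum_(i < M) F i p = glue F p.
  by rewrite (glue_eq (nbhs_singleton hM)).
have hn := glue_near hM.
rewrite /continuous_at -E.
apply: (@cvg_trans _ ((\sum_(i < M) F i q) @[q --> p])).
  by apply: near_eq_cvg; apply: filterS hn => q ->.
have [_ cF _ _] := gF; elim: M {hM E hn} => [|M ih].
  under eq_fun do rewrite big_ord0; rewrite big_ord0; exact: cvg_cst.
under eq_fun do rewrite big_ord_recr; rewrite big_ord_recr /=.
by apply: cvgD => //; exact: (cF [::] M p).
Unshelve. all: by end_near. Qed.

Lemma iter_derive_glue F s : glueable F ->
  iter_derive e s (glue F) = glue (fun n => iter_derive e s (F n)).
Proof.
move=> gF; elim: s => [//|i s ih] /=; rewrite ih; apply/funext => p.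
by have [_ ->] := glue_is_derive i p (glueable_pd s gF).
Qed.

Lemma glue_smooth F : glueable F -> moderate e (fun=> setT) (fun=> glue F).
Proof.
move=> gF s; have gs := glueable_pd s gF; rewrite (iter_derive_glue s gF); split.
- by move=> _ i p; case: (glue_is_derive i p gs).
- by move=> _; exact: glue_continuous.
- have [C hC] := glue_bound gs.
  by apply: (@poly_bounded_bounded _ _ _ _ C) => n p _; have [] := hC p.
Qed.

Definition rapid (d : nat -> R) : Prop :=
  forall m, exists C, forall n, `|d n| * n.+1%:R ^+ m <= C.

(** On [K n] a bound by [al n] squared is a bound by [tau] squared. Since the inverse of [al] grows
    polynomially, the rapid factor pays for it, as well as for the derivatives and the weights. *)
Lemma glueable_moderate (K : nat -> set V) (G : nat -> V -> R) (d al : nat -> R) :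
  moderate e K G -> rapid d ->
  (forall n, closed (K n)) -> (forall n p, ~ K n p -> G n p = 0) ->
  (forall n, 0 < al n) -> poly_growth (fun n => (al n)^-1) ->
  (forall n p, K n p -> al n <= tau p) ->
  (forall n p, (0 < n)%N -> K n p -> tau p <= b n) ->
  glueable (fun n p => d n * G n p).
Proof.
move=> mG rd cK G0 al0 [D [k hal]] Kal Kb.
have pdE s n : iter_derive e s (fun p => d n * G n p) = (fun p => d n * iter_derive e s (G n) p).
  elim: s => [//|i s ih] /=; rewrite ih; apply/funext => p.
  by have [/(_ n i p) h _ _] := mG s; exact: (deriveZ (d n) h).
split.
- move=> s n i p; rewrite pdE.
  by have [/(_ n i p) h _ _] := mG s;
     exact: (@derivableZ _ _ _ (iter_derive e s (G n)) (d n) p (e i) h).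
- move=> s n p; rewrite pdE; have [_ /(_ n p) h _] := mG s.
  by apply: cvgM; [exact: cvg_cst|exact: h].
- move=> n p n0 bp; rewrite G0 ?mulr0// => Kp.
  by move: bp; rewrite ltNge (Kb n p n0 Kp).
- move=> s; have [_ _ [C [m hC]]] := mG s.
  (* m powers of n.+1 are spent on the derivative, 2 on the weight, and 2k on bounding tau^-2 by
     al^-2. *)
  have [E hE] := rd (m + 2 + (k + k))%N.
  have D0 : 0 <= D by have := hal 0%N; rewrite expr1n mulr1; exact: le_trans.
  have E0 : 0 <= E by have := hE 0%N; apply: le_trans; rewrite mulr_ge0 ?exprn_ge0.
  have w0 n : 0 < n.+1%:R * n.+2%:R :> R by rewrite mulr_gt0.
  have wle n : n.+1%:R * n.+2%:R <= 2 * n.+1%:R ^+ 2 :> R.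
    rewrite expr2 mulrCA ler_wpM2l// -natrM ler_nat.
    by rewrite mul2n -addnn addnS ltnS leq_addr.
  (* The 2 comes from [wle]; the last factor serves both required bounds, 1 for the uniform one and
     D * D for the quadratic one. *)
  pose B := `|C| * 2 * E * (1 + D * D).
  have N1 n : (1 <= n.+1%:R :> R) by rewrite ler1n.
  have key n p : K n p -> (`|d n * iter_derive e s (G n) p| <= B * weight R n) /\
     (`|d n * iter_derive e s (G n) p| <= B * weight R n * tp p ^+ 2).
    move=> Kp; have a0 := al0 n; have t0 := lt_le_trans a0 (Kal _ _ Kp).
    rewrite /tp max_r ?(ltW t0)//.
    have X : `|d n * iter_derive e s (G n) p| * (n.+1%:R * n.+2%:R) <=
             `|C| * 2 * (`|d n| * n.+1%:R ^+ (m + 2)).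
      rewrite normrM exprD.
      have h1 : `|iter_derive e s (G n) p| <= `|C| * n.+1%:R ^+ m.
        apply: le_trans (hC n p Kp) _; rewrite ler_wpM2r ?exprn_ge0//.
        exact: ler_norm.
      apply: le_trans (ler_pM _ _ (ler_wpM2l (normr_ge0 (d n)) h1) (wle n)) _.
      - by rewrite mulr_ge0.
      - exact: ltW.
      by rewrite le_eqVlt; apply/orP; left; apply/eqP; ring.
    split.
    - rewrite /weight ler_pdivlMr//; apply: le_trans X _.
      rewrite /B -!mulrA !ler_wpM2l// mulrDr mulr1.
      apply: (@le_trans _ _ E); last by rewrite lerDl !mulr_ge0.
      apply: le_trans (hE n); rewrite ler_wpM2l// ler_weXn2l// leq_addr//.
    - rewrite -mulrA [weight _ _ * _]mulrC mulrA /weight ler_pdivlMr//.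
      apply: le_trans X _; rewrite -ler_pdivrMr ?exprn_gt0//.
      rewrite /B -!mulrA !ler_wpM2l//.
      have h2 : (tau p ^+ 2)^-1 <= D * D * n.+1%:R ^+ (k + k).
        apply: (@le_trans _ _ ((al n)^-1 * (al n)^-1)).
          rewrite -invfM -expr2 lef_pV2 ?posrE ?exprn_gt0//.
          by rewrite lerXn2r// ?nnegrE ?(ltW a0) ?(ltW t0)// Kal.
        rewrite exprD mulrACA; have := hal n.
        by rewrite ger0_norm ?invr_ge0 ?(ltW a0)// => h2; rewrite ler_pM// invr_ge0 ltW.
      rewrite mulrA; apply: le_trans (ler_wpM2l _ h2) _.
        by rewrite mulr_ge0// exprn_ge0.
      apply: (@le_trans _ _ (E * (D * D))); last first.
        by rewrite ler_wpM2l// lerDr.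
      rewrite mulrCA mulrA [E * _]mulrC -mulrA ler_wpM2l ?mulr_ge0//.
      rewrite -mulrA -exprD. exact: hE.
  exists B => n p; rewrite pdE; have [Kp|Kp] := pselect (K n p); first exact: key.
  have -> : iter_derive e s (G n) p = 0.
    apply: (@iter_derive_zero _ _ _ e (G n) (~` K n)) => //; first exact: closed_openC.
    by move=> q; exact: G0.
  have D1 : 0 <= 1 + D * D by rewrite addr_ge0// mulr_ge0.
  have B0 : 0 <= B by rewrite /B !mulr_ge0.
  have w1 := weight_ge0 R n.
  by rewrite mulr0 normr0; split;
    do ?[exact: mulr_ge0|apply: mulr_ge0; [exact: mulr_ge0|exact: sqr_ge0]].
Qed.

Lemma glueable_add F G : glueable F -> glueable G -> glueable (fun n p => F n p + G n p).
Proof.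
move=> [h1 h2 h3 h4] [k1 k2 k3 k4].
have pdE s n : iter_derive e s (fun p => F n p + G n p) =
    (fun p => iter_derive e s (F n) p + iter_derive e s (G n) p).
  by apply: iter_derive_add => s' i p.
split.
- by move=> s n i p; rewrite pdE; exact: (derivableD (h1 s n i p) (k1 s n i p)).
- by move=> s n p; rewrite pdE; apply: cvgD; [exact: h2|exact: k2].
- by move=> n p n0 bp; rewrite h3// k3// addr0.
- move=> s; have [C hC] := h4 s; have [D hD] := k4 s; exists (C + D) => n p.
  have [c1 c2] := hC n p; have [d1 d2] := hD n p; rewrite pdE !mulrDl.
  by split; apply: le_trans (ler_normD _ _) _; exact: lerD.
Qed.

End Glue.

(** * The parameters *)

Section Construction.
Context {R : realType}.
Variable n0 : nat.
(** From 30 on, [dl n] <= 15 / N is at most 1/2. A further lower bound on [n0], depending on the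
    derivative of [step], is imposed from [ell_bounds] on. *)
Hypothesis n0_ge : (30 <= n0)%N.
Implicit Types (n : nat) (x y : R).

(* The switches take place in the strips [aa n.+1 <= t <= aa n], of length
   [rr n]. The shift by [n0] makes the estimates valid from [n = 0] on. *)
Definition NN n : R := (n0 + n)%:R.
Definition LL x : R := Num.sqrt (ln x).
Definition aa n : R := expR (- LL (NN n)).
(** Minus the derivative of x |-> expR (- LL x); the mean value theorem then compares [rr n] with
    it. *)
Definition slope x : R := expR (- LL x) / (2 * x * LL x).
Definition rr n : R := aa n - aa n.+1.

Lemma NN_ge n : 30 <= NN n.
Proof. by rewrite ler_nat (leq_trans n0_ge)// leq_addr. Qed.

Lemma NN_gt0 n : 0 < NN n.
Proof. by apply: lt_le_trans (NN_ge n); rewrite ltr0n. Qed.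

Lemma NN_gt1 n : 1 < NN n.
Proof. by apply: lt_le_trans (NN_ge n); rewrite ltr1n. Qed.

Lemma NNS n : NN n.+1 = NN n + 1.
Proof. by rewrite /NN addnS -natr1. Qed.

Lemma LL_gt0 x : 1 < x -> 0 < LL x.
Proof. by move=> x1; rewrite sqrtr_gt0 ln_gt0. Qed.

Lemma LL_ge0 x : 0 <= LL x.
Proof. exact: sqrtr_ge0. Qed.

Lemma LL_sqr x : 1 <= x -> LL x ^+ 2 = ln x.
Proof. by move=> x1; rewrite sqr_sqrtr// ln_ge0. Qed.

Lemma LL_le x y : 1 <= x -> x <= y -> LL x <= LL y.
Proof.
by move=> x1 xy; rewrite ler_wsqrtr// ler_ln ?posrE// (lt_le_trans ltr01)// (le_trans x1).
Qed.

Lemma is_derive_aa x : 1 < x -> is_derive x 1 (fun y => expR (- LL y)) (- slope x).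
Proof.
move=> x1; have x0 : 0 < x by apply: lt_trans x1.
have l0 : 0 < ln x by rewrite ln_gt0.
have d1 : is_derive x 1 (@LL) ((2 * Num.sqrt (ln x))^-1 * x^-1).
  exact: (@is_derive_comp1 R R Num.sqrt (@ln R) x 1 _ _ (is_derive1_sqrt l0) (is_derive1_ln x0)).
have d2 : is_derive x 1 (fun y => - LL y) (- ((2 * Num.sqrt (ln x))^-1 * x^-1)).
  exact: is_deriveN d1.
have d3 := @is_derive_comp1 R R expR (fun y => - LL y) x 1 _ _ (is_derive_expR _) d2.
apply: is_derive_eq d3 _.
rewrite /slope /LL; have s0 : Num.sqrt (ln x) != 0 by rewrite gt_eqF// sqrtr_gt0.
by field; rewrite s0 gt_eqF.
Qed.

Lemma slope_decr x y : 1 < x -> x <= y -> slope y <= slope x.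
Proof.
move=> x1 xy; have y1 := lt_le_trans x1 xy.
have x0 : 0 < x by apply: lt_trans x1.
have y0 : 0 < y by apply: lt_trans y1.
have Lxy := LL_le (ltW x1) xy.
have := LL_gt0 x1; have := LL_gt0 y1 => Ly Lx.
rewrite /slope ler_pM ?expR_ge0 ?invr_ge0//.
- by rewrite !mulr_ge0// ltW.
- by rewrite ler_expR lerN2.
- rewrite lef_pV2 ?posrE ?mulr_gt0//.
  by rewrite ler_pM ?mulr_ge0 ?(ltW x0) ?(ltW Lx)// ler_wpM2l.
Qed.

Lemma rr_slope n : slope (NN n.+1) <= rr n <= slope (NN n).
Proof.
have n1 := NN_gt1 n; have lt : NN n < NN n.+1 by rewrite NNS ltrDl.
have [||c] := @MVT R (fun y => expR (- LL y)) (fun y => - slope y) (NN n) (NN n.+1) lt.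
- move=> x; rewrite in_itv /= => /andP[h _]; apply: is_derive_aa; exact: lt_trans h.
- apply: derivable_within_continuous => x; rewrite in_itv /= => /andP[h _].
  by case: (is_derive_aa (lt_le_trans n1 h)).
- rewrite in_itv /= => /andP[h1 h2] E.
  have -> : rr n = slope c.
    rewrite /rr /aa; move: E; set A := expR _; set B := expR _ => E.
    by rewrite -[B - A]opprB E NNS addrAC subrr add0r mulr1 opprK.
  by rewrite !slope_decr ?(ltW h1) ?(ltW h2)//; exact: lt_trans h1.
Qed.

Lemma rr_ge n : slope (NN n.+1) <= rr n.
Proof. by have /andP[] := rr_slope n. Qed.

Lemma slope_gt0 x : 1 < x -> 0 < slope x.
Proof.
move=> x1; rewrite divr_gt0 ?expR_gt0// !mulr_gt0 ?LL_gt0//; exact: lt_trans x1.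
Qed.

Lemma rr_gt0 n : 0 < rr n.
Proof. apply: lt_le_trans (rr_ge n); apply: slope_gt0; exact: NN_gt1. Qed.

Lemma rr_decr n : rr n.+1 <= rr n.
Proof.
by have /andP[_ h1] := rr_slope n.+1; have /andP[h2 _] := rr_slope n; exact: le_trans h2.
Qed.

Lemma aa_gt0 n : 0 < aa n. Proof. exact: expR_gt0. Qed.

Lemma aa_le1 n : aa n <= 1.
Proof. by rewrite -expR0 ler_expR oppr_le0 LL_ge0. Qed.

Lemma aa_lt n : aa n.+1 < aa n.
Proof. by rewrite -subr_gt0 rr_gt0. Qed.

Lemma aa_le m n : (m <= n)%N -> aa n <= aa m.
Proof.
move=> /subnK <-; elim: (n - m)%N => [//|k ih]; rewrite addSn.
by apply: le_trans ih; exact/ltW/aa_lt.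
Qed.

Lemma aa_cvg0 eps : 0 < eps -> exists M, forall n, (M <= n)%N -> aa n < eps.
Proof.
move=> e0; pose K := `|ln eps| + 1.
have K0 : 0 <= K by rewrite addr_ge0.
(* Beyond this index N >= expR (K ^ 2), hence LL N >= K > - ln eps. *)
exists (Num.Def.truncn (expR (K ^+ 2))).+1 => n Mn.
have h : expR (K ^+ 2) <= NN n.
  apply/ltW; apply: lt_le_trans (truncnS_gt _) _; rewrite /NN ler_nat.
  by apply: leq_trans Mn _; exact: leq_addl.
have h2 : K ^+ 2 <= ln (NN n) by rewrite -(expRK (K ^+ 2)) ler_ln ?posrE ?expR_gt0 ?NN_gt0.
have h3 : K <= LL (NN n).
  rewrite -(ger0_norm K0) -sqrtr_sqr; exact: ler_wsqrtr.
rewrite -[ltRHS](@lnK R eps) ?posrE// /aa ltr_expR.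
apply: (@le_lt_trans _ _ (- K)); first by rewrite lerN2.
rewrite ltrNl /K; apply: (@le_lt_trans _ _ `|ln eps|); last by rewrite ltrDl.
by rewrite -normrN ler_norm.
Qed.

(** Put L = [LL x], so that L^2 = ln x. From L <= expR L one gets expR (- L) / L >= expR (- 2 L),
    and 2 L <= s L^2 + 1/s is a completed square. So [slope] decays no faster than x^-(1+s), for
    each s > 0. *)
Lemma slope_ge x s : 1 < x -> 0 < s ->
  expR (- s^-1) / 2 * expR (- (1 + s) * ln x) <= slope x.
Proof.
move=> x1 s0; have x0 : 0 < x by apply: lt_trans x1.
have L0 := LL_gt0 x1; rewrite /slope.
have -> : expR (- (1 + s) * ln x) = x^-1 * expR (- (s * LL x ^+ 2)).
  by rewrite LL_sqr ?(ltW x1)// mulNr mulrDl mul1r opprD expRD expRN lnK ?posrE// mulNr.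
have -> : expR (- LL x) / (2 * x * LL x) = (2 * x)^-1 * (expR (- LL x) / LL x).
  by field; rewrite !gt_eqF.
have -> : expR (- s^-1) / 2 * (x^-1 * expR (- (s * LL x ^+ 2))) =
  (2 * x)^-1 * (expR (- s^-1) * expR (- (s * LL x ^+ 2))).
  by field; rewrite !gt_eqF.
rewrite ler_wpM2l ?invr_ge0 ?mulr_ge0 ?(ltW x0)//.
rewrite ler_pdivlMr// -expRD.
apply: (@le_trans _ _ (expR (- s^-1 + - (s * LL x ^+ 2)) * expR (LL x))).
  by rewrite ler_wpM2l ?expR_ge0//; apply: le_trans (expR_ge1Dx _); rewrite lerDr.
rewrite -expRD ler_expR -subr_ge0.
have -> : - LL x - (- s^-1 + - (s * LL x ^+ 2) + LL x) = s * (LL x - s^-1) ^+ 2.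
  by field; rewrite gt_eqF.
by rewrite mulr_ge0 ?sqr_ge0 ?ltW.
Qed.

Lemma expRN1_ge : 1 / 4 <= expR (- 1) :> R.
Proof.
have -> : (- 1 : R) = - (1 / 2) + - (1 / 2) by lra.
have h : 1 / 2 <= expR (- (1 / 2)) :> R by have := expR_ge1Dx (- (1 / 2) : R); lra.
rewrite expRD; apply: (@le_trans _ _ ((1 / 2) * (1 / 2))); first by lra.
by rewrite ler_pM.
Qed.

(** The case s = 1 of [slope_ge], with expR (-1) / 2 >= 1/8. *)
Lemma rr_ge2 n : (8 * NN n.+1 ^+ 2)^-1 <= rr n.
Proof.
apply: le_trans (rr_ge n); have h := slope_ge (NN_gt1 n.+1) ltr01.
apply: le_trans h; rewrite invr1.
have -> : (- (1 + 1) * ln (NN n.+1)) = - (2%:R * ln (NN n.+1)) by rewrite mulNr.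
rewrite expRN expRM_natl lnK ?posrE ?NN_gt0// invfM.
rewrite ler_wpM2r ?invr_ge0 ?exprn_ge0 ?(ltW (NN_gt0 _))//.
by have := expRN1_ge; lra.
Qed.

(** What Holder continuity asks of an oscillation of size 1/N over the length [rr n]. The exponent s
    is chosen so that (1 + s) * al = 1, which turns the lower bound of [slope_ge], raised to the
    power al, into a multiple of 1 / (N + 1). *)
Lemma rr_holder al : 0 < al < 1 -> exists C, forall n, (NN n)^-1 <= C * rr n `^ al.
Proof.
move=> /andP[al0 al1]; pose s := al^-1 - 1.
have s0 : 0 < s by rewrite subr_gt0 invf_gt1.
pose c := expR (- s^-1) / 2; have c0 : 0 < c by rewrite divr_gt0 ?expR_gt0.
exists (2 * (c `^ al)^-1) => n.
have ca0 : 0 < c `^ al by rewrite powR_gt0.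
have h : c * expR (- (1 + s) * ln (NN n.+1)) <= rr n.
  by apply: le_trans (rr_ge n); apply: slope_ge => //; exact: NN_gt1.
have h2 : c `^ al * (NN n.+1)^-1 <= rr n `^ al.
  have -> : (NN n.+1)^-1 = (expR (- (1 + s) * ln (NN n.+1))) `^ al.
    rewrite -expRM mulNr /s addrC subrK mulNr mulrAC mulVf ?gt_eqF// mul1r.
    by rewrite expRN lnK ?posrE ?NN_gt0.
  rewrite -powRM ?expR_ge0 ?(ltW c0)//.
  by apply: ge0_ler_powR => //;
    rewrite ?nnegrE ?(ltW al0) ?(ltW (rr_gt0 _)) ?mulr_ge0 ?expR_ge0 ?(ltW c0).
apply: (@le_trans _ _ (2 * (NN n.+1)^-1)).
  rewrite -ler_pdivrMl// -invfM lef_pV2 ?posrE ?mulr_gt0 ?NN_gt0//.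
  by rewrite NNS; have := NN_gt1 n; lra.
by rewrite -mulrA ler_wpM2l// mulrC ler_pdivlMr// mulrC.
Qed.

Lemma LLS n : LL (NN n.+1) <= LL (NN n) + 1.
Proof.
have n1 := NN_gt1 n; have N0 := NN_gt0 n.
have L0 := LL_ge0 (NN n).
rewrite -[leRHS]ger0_norm ?addr_ge0// -sqrtr_sqr ler_wsqrtr//.
rewrite sqrrD LL_sqr ?(ltW n1)// expr1n mulr1.
have -> : NN n.+1 = NN n * (1 + (NN n)^-1) by rewrite NNS mulrDr mulr1 mulfV// gt_eqF.
rewrite lnM ?posrE//; last by rewrite addr_gt0 ?invr_gt0.
have : ln (1 + (NN n)^-1) <= 1.
  rewrite -[leRHS]expRK ler_ln ?posrE ?expR_gt0 ?addr_gt0 ?invr_gt0//.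
  apply: le_trans (expR_ge1Dx 1); rewrite lerD2l invf_le1// ltW//.
by move: (ln _) (ln _) => A B h; rewrite -addrA lerD2l ler_wpDl// mulrn_wge0.
Qed.

(** The estimate behind the bound on l'. The left side is of order L * expR L, where expR L is the
    inverse of [aa n], and expR (eps * L) absorbs the factor L. *)
Lemma rr_aa eps : 0 < eps -> exists2 C, 0 <= C &
  forall n, (NN n * rr n)^-1 <= C * aa n `^ (- (1 + eps)).
Proof.
(* 4 bounds 2 (N + 1) / N up to rounding, expR 1 comes from [LLS], and the last factor from L + 1 <=
   (1 + 1/eps) * expR (eps * L). *)
move=> e0; exists (4 * expR 1 * (1 + eps^-1)).
  by rewrite !mulr_ge0 ?expR_ge0 ?addr_ge0 ?invr_ge0 ?(ltW e0).
move=> n; have N0 := NN_gt0 n; have N1 := NN_gt1 n; have M0 := NN_gt0 n.+1.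
set L := LL (NN n); set L' := LL (NN n.+1).
have L0 : 0 < L by exact: LL_gt0.
have L'0 : 0 < L' by apply: LL_gt0; exact: NN_gt1.
have -> : aa n `^ (- (1 + eps)) = expR L * expR (eps * L).
  rewrite /aa -expRM -expRD; congr expR.
  by rewrite mulrNN mulrDr mulr1 [eps * _]mulrC.
have h1 : (NN n * slope (NN n.+1))^-1 <= 4 * L' * expR L'.
  rewrite /slope -/L' expRN.
  have -> : (NN n * ((expR L')^-1 / (2 * NN n.+1 * L')))^-1 = 2 * (NN n.+1 / NN n) * L' * expR L'.
    have gen (a b c d : R) : a != 0 -> b != 0 -> c != 0 -> d != 0 ->
        (a * (d^-1 / (2 * b * c)))^-1 = 2 * (b / a) * c * d.
      by move=> ? ? ? ?; field; do ?[apply/andP; split].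
    by rewrite gen ?gt_eqF ?expR_gt0.
  rewrite ler_wpM2r ?expR_ge0// ler_wpM2r ?(ltW L'0)//.
  have : NN n.+1 / NN n <= 2 by rewrite ler_pdivrMr// NNS; lra.
  by move=> ?; lra.
apply: (@le_trans _ _ (NN n * slope (NN n.+1))^-1).
  have sl0 : 0 < slope (NN n.+1) by apply: slope_gt0; exact: NN_gt1.
  have r0 := rr_gt0 n.
  by rewrite lef_pV2 ?posrE ?(mulr_gt0 N0 sl0) ?(mulr_gt0 N0 r0)// ler_pM2l ?rr_ge.
apply: le_trans h1 _; have LS := LLS n.
apply: (@le_trans _ _ (4 * (L + 1) * expR (L + 1))).
  by rewrite ler_pM ?mulr_ge0 ?expR_ge0 ?(ltW L'0)// ?ler_expR// ler_wpM2l.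
rewrite expRD.
have h3 : L + 1 <= (1 + eps^-1) * expR (eps * L).
  have E := expR_ge1Dx (eps * L).
  apply: (@le_trans _ _ ((1 + eps^-1) * (1 + eps * L))).
    rewrite mulrDl mul1r mulrDr mulr1 mulrA mulVf ?gt_eqF// mul1r.
    have i0 : 0 < eps^-1 by rewrite invr_gt0.
    have : 0 <= eps * L by rewrite mulr_ge0// ltW.
    by move: (ltW i0); set A := eps^-1; set B := eps * L; move=> ? ?; lra.
  by rewrite ler_wpM2l// addr_ge0// invr_ge0 ltW.
apply: (@le_trans _ _ (4 * ((1 + eps^-1) * expR (eps * L)) * (expR L * expR 1))).
  by rewrite ler_wpM2r ?mulr_ge0 ?expR_ge0// ler_wpM2l.
by rewrite le_eqVlt; apply/orP; left; apply/eqP; ring.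
Qed.

(* The n-th mode is [expR (zz n * t - QQ n) * cos (kk n * x1)]; consecutive modes
   agree in size at [aa n] and have ratio [expR (- pp n)] at [aa n.+1]. *)
Definition kk n : R := NN n ^+ 2.
Definition zz n : R := NN n ^+ 4.
Definition zd n : R := zz n.+1 - zz n.
Definition pp n : R := zd n * rr n.
(** The relative gap between consecutive rates; up to a constant factor it is the amplitude of l - 1
    on the n-th strip, see [glE]. *)
Definition dl n : R := zd n / zz n.
Fixpoint QQ n : R := if n is m.+1 then QQ m + zd m * aa m else zz 0 * aa 0.
(** Minus the logarithm of the common size of modes n and n.+1 at time [aa n]. *)
Definition qq n : R := QQ n - zz n * aa n.

Lemma zdE n : zd n = 4 * NN n ^+ 3 + 6 * NN n ^+ 2 + 4 * NN n + 1.
Proof. by rewrite /zd /zz NNS; ring. Qed.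

Lemma zz_gt0 n : 0 < zz n. Proof. by rewrite exprn_gt0// NN_gt0. Qed.
Lemma kk_gt0 n : 0 < kk n. Proof. by rewrite exprn_gt0// NN_gt0. Qed.
Lemma kk_sqr n : kk n ^+ 2 = zz n. Proof. by rewrite /kk -exprM. Qed.
Lemma kk_ge1 n : 1 <= kk n. Proof. by rewrite exprn_ege1// ltW// NN_gt1. Qed.

Lemma zd_ge n : 4 * NN n ^+ 3 <= zd n.
Proof.
rewrite zdE; have N0 := ltW (NN_gt0 n).
by have := exprn_ge0 2 N0; move: (NN n ^+ 2) (NN n ^+ 3) => A B; lra.
Qed.

Lemma zd_gt0 n : 0 < zd n.
Proof. by apply: lt_le_trans (zd_ge n); rewrite mulr_gt0// exprn_gt0// NN_gt0. Qed.

Lemma dl_gt0 n : 0 < dl n. Proof. by rewrite divr_gt0 ?zd_gt0 ?zz_gt0. Qed.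

(** 15 = 4 + 6 + 4 + 1 is the sum of the coefficients in [zdE], every power of N there being at most
    N^3. *)
Lemma dl_le n : dl n <= 15 / NN n.
Proof.
have N0 := NN_gt0 n; have N1 := ltW (NN_gt1 n).
rewrite /dl ler_pdivrMr ?zz_gt0// /zz exprS mulrA divfK ?gt_eqF// zdE.
have h2 : NN n <= NN n ^+ 2 by rewrite expr2 ler_peMl// ltW.
have h3 : NN n ^+ 2 <= NN n ^+ 3 by rewrite [leRHS]exprS ler_peMl// exprn_ge0// ltW.
by move: (NN n ^+ 2) (NN n ^+ 3) h2 h3 N1 => A B; lra.
Qed.

Lemma dl_le2 n : dl n <= 1 / 2.
Proof.
apply: le_trans (dl_le n) _; rewrite ler_pdivrMr ?NN_gt0//.
by have := NN_ge n; lra.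
Qed.

Lemma ppE n : pp n = dl n * zz n * rr n.
Proof. by rewrite /dl divfK// gt_eqF// zz_gt0. Qed.

Lemma pp_ge n : NN n / 8 <= pp n.
Proof.
have N0 := NN_gt0 n; have N1 := NN_gt1 n.
apply: (@le_trans _ _ (4 * NN n ^+ 3 * (8 * NN n.+1 ^+ 2)^-1)).
  have M2 : NN n.+1 <= 2 * NN n by rewrite NNS; lra.
  rewrite ler_pdivlMr ?mulr_gt0 ?exprn_gt0 ?NN_gt0//.
  have -> : NN n / 8 * (8 * NN n.+1 ^+ 2) = NN n * NN n.+1 ^+ 2 by field.
  apply: (@le_trans _ _ (NN n * (2 * NN n) ^+ 2)).
    rewrite ler_wpM2l ?(ltW N0)// lerXn2r ?nnegrE ?(ltW (NN_gt0 _))// mulr_ge0// ltW//.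
  by rewrite le_eqVlt; apply/orP; left; apply/eqP; ring.
rewrite /pp ler_pM ?zd_ge ?rr_ge2//.
  by rewrite mulr_ge0 ?exprn_ge0 ?(ltW N0).
by rewrite invr_ge0 mulr_ge0 ?exprn_ge0 ?(ltW (NN_gt0 _)).
Qed.

Lemma pp_ge1 n : 1 <= pp n.
Proof. by apply: le_trans (pp_ge n); have := NN_ge n; lra. Qed.

Lemma pp_gt0 n : 0 < pp n.
Proof. by apply: lt_le_trans (pp_ge1 n). Qed.

Lemma expR_pp n : expR (- pp n) <= 1 / 2.
Proof.
rewrite expRN div1r lef_pV2 ?posrE ?expR_gt0//.
by apply: le_trans (expR_ge1Dx _); have := pp_ge1 n; lra.
Qed.

Lemma qq0 : qq 0 = 0. Proof. by rewrite /qq /= subrr. Qed.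

Lemma qqS n : qq n.+1 = qq n + zz n.+1 * rr n.
Proof. by rewrite /qq /= /zd /rr; ring. Qed.

Lemma zzrr_ge1 n : 1 <= zz n.+1 * rr n.
Proof.
apply: le_trans (pp_ge1 n) _; rewrite /pp ler_wpM2r ?(ltW (rr_gt0 _))//.
by rewrite /zd gerBl ltW// zz_gt0.
Qed.

Lemma qq_ge n : n%:R <= qq n.
Proof.
elim: n => [|n ih]; first by rewrite qq0.
by rewrite qqS -natr1 lerD// zzrr_ge1.
Qed.

(** Mode n.+1 lives below [aa n] and is largest at that time, where its size is expR (- qq n). *)
Lemma phase_v n t : t <= aa n -> zz n.+1 * t - QQ n.+1 <= - n%:R.
Proof.
move=> ta; apply: (@le_trans _ _ (- qq n)); last by rewrite lerN2 qq_ge.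
have -> : - qq n = zz n.+1 * aa n - QQ n.+1 by rewrite /qq /= /zd; ring.
by rewrite lerD2r ler_wpM2l// ltW// zz_gt0.
Qed.

(** The auxiliary wave stays small even when raised by expR (2 p): as [dl] is at most 1/2 and [rr]
    decreases, 2 p does not exceed the decay of mode n.+1 across the preceding strip. *)
Lemma phase_w n t : t <= aa n.+1 ->
  zz n.+1 * t - QQ n.+1 + 2 * pp n.+1 <= - n%:R.
Proof.
move=> ta; apply: (@le_trans _ _ (- qq n)); last by rewrite lerN2 qq_ge.
have h : zz n.+1 * t - QQ n.+1 <= - qq n.+1.
  by rewrite /qq opprB addrC [leRHS]addrC lerD2l ler_wpM2l// ltW// zz_gt0.
have h2 : 2 * pp n.+1 <= zz n.+1 * rr n.
  rewrite ppE; apply: (@le_trans _ _ (zz n.+1 * rr n.+1)).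
    rewrite -mulrA mulrA ler_piMl//.
      by rewrite mulr_ge0 ?(ltW (zz_gt0 _)) ?(ltW (rr_gt0 _)).
    by have := dl_le2 n.+1; lra.
  by rewrite ler_wpM2l ?rr_decr// ltW// zz_gt0.
rewrite qqS in h; move: h h2; set A := zz _ * t; set B := zz _ * rr _; set C := pp _.
by lra.
Qed.

(** * Polynomial growth and rapid decay of the parameters *)

Lemma poly_growth_NN : poly_growth NN.
Proof.
exists n0%:R, 1%N => n; rewrite expr1 ger0_norm ?(ltW (NN_gt0 _))//.
rewrite /NN -natrM ler_nat mulnS leq_add2l leq_pmull//.
by apply: leq_trans n0_ge.
Qed.

Lemma poly_growth_ext (c d : nat -> R) : poly_growth c ->
  (forall n, `|d n| <= `|c n|) -> poly_growth d.
Proof. by move=> [C [m h]] cd; exists C, m => n; exact: le_trans (h n). Qed.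

Lemma poly_growth_expr (c : nat -> R) m : poly_growth c -> poly_growth (fun n => c n ^+ m).
Proof.
move=> h; elim: m => [|m ih].
  by apply: poly_growth_ext (poly_growth_const 1) _ => n; rewrite expr0.
by apply: poly_growth_ext (poly_growth_mul h ih) _ => n; rewrite exprS.
Qed.

Lemma poly_growth_kk : poly_growth kk. Proof. exact: poly_growth_expr poly_growth_NN. Qed.
Lemma poly_growth_zz : poly_growth zz. Proof. exact: poly_growth_expr poly_growth_NN. Qed.

Lemma poly_growth_shift (c : nat -> R) : poly_growth c -> poly_growth (fun n => c n.+1).
Proof.
move=> [C [m h]]; exists (`|C| * 2 ^+ m), m => n; apply: le_trans (h _) _.
apply: (@le_trans _ _ (`|C| * n.+2%:R ^+ m)).
  by rewrite ler_wpM2r ?exprn_ge0// ler_norm.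
rewrite -mulrA ler_wpM2l// -exprMn lerXn2r ?nnegrE// ?mulr_ge0//.
by rewrite -natrM ler_nat mul2n -addnn addnS ltnS leq_addr.
Qed.

Lemma poly_growth_kkV : poly_growth (fun n => (kk n)^-1).
Proof.
apply: poly_growth_ext (poly_growth_const 1) _ => n.
rewrite ger0_norm ?normr1 ?invr_ge0 ?(ltW (kk_gt0 _))//.
by rewrite invf_le1 ?kk_gt0 ?kk_ge1.
Qed.

Lemma poly_growth_rrV : poly_growth (fun n => (rr n)^-1).
Proof.
have h := poly_growth_mul (poly_growth_const 8)
  (poly_growth_expr 2 (poly_growth_shift poly_growth_NN)).
apply: poly_growth_ext h _ => n.
rewrite ger0_norm ?invr_ge0 ?(ltW (rr_gt0 _))//.
rewrite ger0_norm; last by rewrite mulr_ge0 ?exprn_ge0 ?(ltW (NN_gt0 _)).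
rewrite -[leRHS]invrK lef_pV2 ?posrE ?rr_gt0 ?rr_ge2//.
by rewrite invr_gt0 mulr_gt0 ?exprn_gt0 ?NN_gt0.
Qed.

Lemma poly_growth_aaV : poly_growth (fun n => (aa n)^-1).
Proof.
apply: poly_growth_ext poly_growth_rrV _ => n.
rewrite !ger0_norm ?invr_ge0 ?(ltW (rr_gt0 _)) ?(ltW (aa_gt0 _))//.
rewrite lef_pV2 ?posrE ?aa_gt0 ?rr_gt0//.
by rewrite /rr gerBl ltW// aa_gt0.
Qed.

Lemma poly_growth_pp : poly_growth pp.
Proof.
apply: poly_growth_ext (poly_growth_shift poly_growth_zz) _ => n.
rewrite !ger0_norm ?(ltW (pp_gt0 _)) ?(ltW (zz_gt0 _))//.
apply: (@le_trans _ _ (zz n.+1 * 1)); last by rewrite mulr1.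
rewrite /pp ler_pM ?(ltW (zd_gt0 _)) ?(ltW (rr_gt0 _))//.
  by rewrite /zd gerBl ltW// zz_gt0.
by rewrite /rr; have := aa_le1 n; have := aa_gt0 n.+1; lra.
Qed.

Lemma rapid_exp (c : nat -> R) : (forall n, n.+1%:R / 8 <= c n) ->
  rapid (fun n => expR (- c n)).
Proof.
move=> h m; exists (8 ^+ m * m`!%:R) => n.
rewrite ger0_norm ?expR_ge0// mulrC expRN ler_pdivrMr ?expR_gt0//.
apply: (@le_trans _ _ (8 ^+ m * m`!%:R * expR (n.+1%:R / 8))).
  rewrite -mulrA -ler_pdivrMl ?exprn_gt0// -exprVn -exprMn mulrC.
  exact: expr_le_fact_exp.
by rewrite ler_wpM2l ?ler_expR// mulr_ge0.
Qed.

Lemma rapid_pp : rapid (fun n => expR (- pp n)).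
Proof.
apply: rapid_exp => n; apply: le_trans (pp_ge n); rewrite ler_wpM2r//.
by rewrite /NN ler_nat -add1n leq_add2r; apply: leq_trans n0_ge.
Qed.

Lemma rapid_nat : rapid (fun n => expR (- n%:R : R)).
Proof.
move=> m; have [//|C hC] := @rapid_exp (fun n => n.+1%:R) _ m.
  by move=> n; rewrite ler_pdivrMr// ler_peMr// ler1n.
exists (expR 1 * C) => n; have := hC n.
rewrite !ger0_norm ?expR_ge0// -natr1 opprD expRD => h.
rewrite -ler_pdivrMl ?expR_gt0// mulrA -expRN [expR (-1) * _]mulrC.
exact: h.
Qed.

(** * Cutoffs *)

Lemma is_derive_affine (V : normedModType R) (f : V -> R) (p v : V) (c : R) :
  (forall h : R, f (h *: v + p) = f p + h * c) -> is_derive p v f c.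
Proof.
move=> hf.
suff h : (fun h : R => h^-1 *: ((f \o shift p) (h *: v) - f p)) @ 0^' --> (c : R).
  by split; [apply/cvg_ex; exists c; exact: h|rewrite /derive; apply: cvg_lim h].
apply: cvg_near_cst; near=> h; rewrite /= hf addrAC subrr add0r.
rewrite /GRing.scale /= mulrA mulVf ?mul1r//; near: h; exact: nbhs_dnbhs_neq.
Unshelve. all: by end_near. Qed.

Definition E3 := (R * (R * R))%type.
Definition cT (p : E3) : R := p.1.
Definition cX (p : E3) : R := p.2.1.
Definition cY (p : E3) : R := p.2.2.

Lemma coordinate_cT : coordinate (axis R) cT.
Proof.
split; first by move=> p; exact: cvg_fst.
move=> i; exists (axis R i).1 => p; apply: is_derive_affine => h.
by rewrite /cT /= addrC.
Qed.

Lemma coordinate_cX : coordinate (axis R) cX.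
Proof.
split.
  move=> p; apply: (@continuous_comp _ _ _ (fun q : E3 => q.2) (fun q : R * R => q.1)).
    exact: cvg_snd.
  exact: cvg_fst.
move=> i; exists (axis R i).2.1 => p; apply: is_derive_affine => h.
by rewrite /cX /= addrC.
Qed.

Lemma coordinate_cY : coordinate (axis R) cY.
Proof.
split.
  move=> p; apply: (@continuous_comp _ _ _ (fun q : E3 => q.2) (fun q : R * R => q.2)).
    exact: cvg_snd.
  exact: cvg_snd.
move=> i; exists (axis R i).2.2 => p; apply: is_derive_affine => h.
by rewrite /cY /= addrC.
Qed.

Lemma cT_axis i (p : E3) (h : R) : `|cT (h *: axis R i + p) - cT p| <= `|h|.
Proof.
rewrite /cT /= addrK /GRing.scale /= normrM ler_piMr//.
by case: i => -[|[|[|//]]] ? /=; rewrite ?normr1 ?normr0.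
Qed.

(** The span of cos and sin is stable under derivation, so the induction on the order closes. *)
Lemma Cb1_cos_sin (a b : R) : Cb1 (fun x : R => a * cos x + b * sin x).
Proof.
have D (c d x : R) : is_derive x 1 (fun x : R => c * cos x + d * sin x)
    (d * cos x + (- c) * sin x).
  have h := is_deriveD (is_deriveZ c (is_derive_cos x)) (is_deriveZ d (is_derive_sin x)).
  apply: is_derive_eq h _; rewrite /GRing.scale /=; ring.
move=> j.
have [c [d ->]] : exists c d, derive1n j (fun x : R => a * cos x + b * sin x) =
    (fun x : R => c * cos x + d * sin x).
  elim: j => [|j [c [d ih]]]; first by exists a, b.
  exists d, (- c); rewrite derive1nS ih; apply/funext => x; rewrite derive1E.
  by have [_ ->] := D c d x.
split; first by move=> x; case: (D c d x).
exists (`|c| + `|d|) => x; apply: le_trans (ler_normD _ _) _.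
by rewrite !normrM lerD// ler_piMr// ?cos_max// ?sin_max.
Qed.

Lemma Cb1_cos : Cb1 (@cos R).
Proof.
have := Cb1_cos_sin 1 0; congr Cb1; apply/funext => x.
by rewrite mul1r mul0r addr0.
Qed.

Lemma Cb1_sin : Cb1 (@sin R).
Proof.
have := Cb1_cos_sin 0 1; congr Cb1; apply/funext => x.
by rewrite mul1r mul0r add0r.
Qed.

(* Locked, lest unification unfold the limit in [derive1]. *)
Definition dstep : R -> R := locked (derive1 (@step R)).

Lemma Cb1_dstep : Cb1 dstep.
Proof. rewrite /dstep -lock; exact: Cb1_derive1 step_Cb1. Qed.

Lemma is_derive_step (x : R) : is_derive x 1 (@step R) (dstep x).
Proof. rewrite /dstep -lock; exact: Cb1_is_derive step_Cb1. Qed.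

(** The endpoint 0 is included, where [step] is not locally constant: [step] attains its minimum
    there. Likewise for the maximum at 1 in [dstep_ge1]. *)
Lemma dstep_le0 x : x <= 0 -> dstep x = 0.
Proof.
move=> x0; rewrite /dstep -lock derive1E.
have h : is_derive x 1 (@step R) 0.
  apply: (@derive1_at_min _ _ (x - 1) (x + 1)).
  - by lra.
  - by move=> t _; case: (is_derive_step t).
  - by rewrite in_itv /=; apply/andP; split; lra.
  - by move=> t _; rewrite (step_le0 x0) step_ge0.
by case: h.
Qed.

Lemma dstep_ge1 x : 1 <= x -> dstep x = 0.
Proof.
move=> x1; rewrite /dstep -lock derive1E.
have h : is_derive x 1 (@step R) 0.
  apply: (@derive1_at_max _ _ (x - 1) (x + 1)).
  - by lra.
  - by move=> t _; case: (is_derive_step t).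
  - by rewrite in_itv /=; apply/andP; split; lra.
  - by move=> t _; rewrite (step_ge1 x1) step_le1.
by case: h.
Qed.

(* The identity on [0, 1], cut off to make the first mode bounded for large
   times. *)
Definition th x : R := x * (step (x + 1) * (1 - step (x - 1))).

Lemma th_id x : 0 <= x <= 1 -> th x = x.
Proof.
move=> /andP[x0 x1]; rewrite /th step_ge1 ?step_le0 ?subr0 ?mulr1//; lra.
Qed.

Lemma Cb1_th : Cb1 th.
Proof.
pose K : set R := `[-1, 2]%classic; apply: (@Cb1_moderate _ K).
- apply: tame_moderate; apply: tame_mul.
    have h := @tame_lin R R unit (@unit_dir R) (fun=> K) id (fun=> 1) (fun=> 0)
      (@coordinate_id R) (poly_growth_const 1).
    apply: tame_ext (h _) _; last by move=> n p; rewrite mul1r addr0.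
    apply: (@poly_bounded_bounded _ _ _ _ 2) => n p; rewrite /K /= in_itv /= => /andP[h1 h2].
    by rewrite mul1r addr0 ler_norml; apply/andP; split; lra.
  apply: tame_mul.
    have h := tame_comp (fun=> K) (fun=> 1) (@coordinate_id R) (poly_growth_const 1) step_Cb1.
    by apply: tame_ext h _ => n p; rewrite mul1r.
  apply: tame_sub; first exact: tame_const.
  have h := tame_comp (fun=> K) (fun=> -1) (@coordinate_id R) (poly_growth_const 1) step_Cb1.
  by apply: tame_ext h _ => n p; rewrite mul1r.
- by apply: closed_openC; exact: interval_closed.
- move=> x; rewrite /K /= in_itv /= => h; rewrite /th.
  have [x1|x1] := ltP x (- 1).
    by rewrite step_le0 ?mul0r ?mulr0//; lra.
  have [x2|x2] := leP x 2.
    by exfalso; apply: h; apply/andP.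
  by rewrite [step (x - 1)]step_ge1 ?subrr ?mulr0//; lra.
Qed.

Lemma dth_id x : 0 < x < 1 -> derive1 th x = 1.
Proof.
move=> /andP[x0 x1]; rewrite derive1E.
rewrite (@near_eq_derive _ _ _ th id) ?derive_id//.
near=> y; apply: th_id; apply/andP; split; apply/ltW; near: y.
- exact: lt_nbhsr.
- exact: lt_nbhsl.
Unshelve. all: by end_near. Qed.

(* [tau n] maps the n-th strip onto [0, 1], with time reversed; [SS j n] is a
   step from 0 to 1 for [tau n] in [j/5, (j+1)/5]. *)
Definition slo n : R := - 5 / rr n.
Definition off n (j : nat) : R := 5 * aa n / rr n - j%:R.
Definition tau n t : R := (aa n - t) / rr n.
Definition SS j n t : R := step (slo n * t + off n j).
Definition dS j n t : R := slo n * dstep (slo n * t + off n j).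

Lemma argE n j t : slo n * t + off n j = 5 * tau n t - j%:R.
Proof. by rewrite /slo /off /tau; ring. Qed.

Lemma SS0 j n t : 5 * tau n t <= j%:R -> SS j n t = 0.
Proof. by move=> h; rewrite /SS argE step_le0// subr_le0. Qed.

Lemma SS1 j n t : j.+1%:R <= 5 * tau n t -> SS j n t = 1.
Proof. by move=> h; rewrite /SS argE step_ge1// lerBrDr addrC natr1. Qed.

Lemma dS0 j n t : 5 * tau n t <= j%:R -> dS j n t = 0.
Proof. by move=> h; rewrite /dS argE dstep_le0 ?mulr0// subr_le0. Qed.

Lemma dS1 j n t : j.+1%:R <= 5 * tau n t -> dS j n t = 0.
Proof. by move=> h; rewrite /dS argE dstep_ge1 ?mulr0// lerBrDr addrC natr1. Qed.

Lemma SS_ge0 j n t : 0 <= SS j n t. Proof. exact: step_ge0. Qed.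
Lemma SS_le1 j n t : SS j n t <= 1. Proof. exact: step_le1. Qed.

Lemma is_derive_arg n j (t : R) : is_derive t 1 (fun t => slo n * t + off n j) (slo n).
Proof. by apply: is_derive_affine => x; rewrite /GRing.scale /=; ring. Qed.

Lemma is_derive_SS j n (t : R) : is_derive t 1 (SS j n) (dS j n t).
Proof.
have := @is_derive_comp1 R R (@step R) (fun t => slo n * t + off n j) t 1 _ _
  (is_derive_step _) (is_derive_arg n j t).
by rewrite mulrC.
Qed.

Lemma tau_ge0 n t : (0 <= tau n t) = (t <= aa n).
Proof. by rewrite /tau pmulr_lge0 ?invr_gt0 ?rr_gt0// subr_ge0. Qed.

Lemma tau_gt0 n t : (0 < tau n t) = (t < aa n).
Proof. by rewrite /tau pmulr_lgt0 ?invr_gt0 ?rr_gt0// subr_gt0. Qed.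

Lemma tau_le1 n t : (tau n t <= 1) = (aa n.+1 <= t).
Proof. by rewrite /tau ler_pdivrMr ?rr_gt0// mul1r /rr lerD2l lerN2. Qed.

Lemma tau_lt1 n t : (tau n t < 1) = (aa n.+1 < t).
Proof. by rewrite /tau ltr_pdivrMr ?rr_gt0// mul1r /rr ltrBlDr; lra. Qed.

Lemma poly_growth_slo : poly_growth slo.
Proof. exact: poly_growth_mul (poly_growth_const _) poly_growth_rrV. Qed.

Lemma tame_SS K j : tame (axis R) K (fun n p => SS j n (cT p)).
Proof. exact: tame_comp coordinate_cT poly_growth_slo step_Cb1. Qed.

Lemma tame_dS K j : tame (axis R) K (fun n p => dS j n (cT p)).
Proof.
apply: (@tame_mul _ _ _ _ K (fun n _ => slo n)); first exact: tame_cst poly_growth_slo.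
exact: tame_comp coordinate_cT poly_growth_slo Cb1_dstep.
Qed.

Lemma tame_trig K (g : R -> R) (k : nat -> R) (c : E3 -> R) :
  coordinate (axis R) c -> Cb1 g -> poly_growth k ->
  tame (axis R) K (fun n p => g (k n * c p)).
Proof.
move=> hc hg hk; have h := tame_comp K (fun=> 0) hc hk hg.
by apply: tame_ext h _ => n p; rewrite addr0.
Qed.

(** * The solution and the lower order coefficients *)

(* [CC n] is the cutoff [SS 2] of the preceding strip, through which mode [n]
   enters; there is none for [n = 0]. *)
Definition slo' n : R := if n is m.+1 then slo m else 0.
(** For n = 0 the argument of [step] in [CC] is the constant 1, so that the cutoff is identically
    1. *)
Definition off' n : R := if n is m.+1 then off m 2 else 1.
Definition CC n t : R := step (slo' n * t + off' n).
Definition dC n t : R := slo' n * dstep (slo' n * t + off' n).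

(* [gV] is the amplitude of the n-th mode, [gW] that of the auxiliary wave. *)
Definition Ev n t : R := expR (zz n * th t - QQ n).
(** Within the strip, the logarithm in units of [pp n] of the size of the auxiliary wave relative to
    mode n, up to its own cutoff. It rises from -2 to 2 as 5 * tau crosses [1, 2] and returns on
    [3, 4]. *)
Definition JJ n t : R := - 2 + 4 * (SS 1 n t - SS 3 n t).
Definition Ew n t : R := expR (zz n * t - QQ n + JJ n t * pp n).
Definition gV n t : R := (1 - SS 2 n t) * CC n t * Ev n t.
Definition gW n t : R := (SS 0 n t - SS 4 n t) * Ew n t.

Definition UU n (p : E3) : R :=
  gV n (cT p) * cos (kk n * cX p) + gW n (cT p) * cos (kk n * cY p).

(** Mode n crosses two strips: it enters through the preceding one and leaves in its own. Mode 0 has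
    no upper end. *)
Definition KV n : set E3 :=
  [set p | aa n.+1 <= cT p /\ ((0 < n)%N -> cT p <= aa n.-1)].
Definition KW n : set E3 := [set p | aa n.+1 <= cT p <= aa n].

Lemma closed_ge_cT (c : R) : closed [set p : E3 | c <= cT p].
Proof.
have h : {in ~` (cT @^-1` [set x | c <= x]), continuous cT}.
  by move=> x _; have [h _] := coordinate_cT; exact: h.
exact: (closed_comp h (@closed_ge R c)).
Qed.

Lemma closed_le_cT (c : R) : closed [set p : E3 | cT p <= c].
Proof.
have h : {in ~` (cT @^-1` [set x | x <= c]), continuous cT}.
  by move=> x _; have [h _] := coordinate_cT; exact: h.
exact: (closed_comp h (@closed_le R c)).
Qed.

Lemma closed_KW n : closed (KW n).
Proof.
have -> : KW n = [set p | aa n.+1 <= cT p] `&` [set p | cT p <= aa n].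
  by apply/seteqP; split => p /= => [/andP[]|[? ?]] //; exact/andP.
by apply: closedI; [exact: closed_ge_cT|exact: closed_le_cT].
Qed.

Lemma closed_KV n : closed (KV n).
Proof.
case: n => [|n].
  have -> : KV 0 = [set p | aa 1 <= cT p].
    by apply/seteqP; split => p /= => [[]|].
  exact: closed_ge_cT.
have -> : KV n.+1 = [set p | aa n.+2 <= cT p] `&` [set p | cT p <= aa n].
  by apply/seteqP; split => p /= => [[? h]|[? ?]]; split => //; exact: h.
by apply: closedI; [exact: closed_ge_cT|exact: closed_le_cT].
Qed.

Lemma JJ_le2 n t : JJ n t <= 2.
Proof. by rewrite /JJ; have := SS_le1 1 n t; have := SS_ge0 3 n t; lra. Qed.

Lemma th_bounded : exists C : R, forall x, `|th x| <= C.
Proof. by have [_ [C h]] := Cb1_th 0%N; exists C. Qed.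

Lemma QQ_le n : QQ n <= zz n.
Proof.
elim: n => [|n ih] /=; first by rewrite ler_piMr ?aa_le1// ltW// zz_gt0.
have := ler_piMr (ltW (zd_gt0 n)) (aa_le1 n); rewrite {2}/zd; lra.
Qed.

Lemma QQ_ge0 n : 0 <= QQ n.
Proof.
elim: n => [|n ih] /=; first by rewrite mulr_ge0 ?(ltW (aa_gt0 _)) ?(ltW (zz_gt0 _)).
by rewrite addr_ge0// mulr_ge0 ?(ltW (aa_gt0 _)) ?(ltW (zd_gt0 _)).
Qed.

Lemma poly_growth_QQ : poly_growth QQ.
Proof.
apply: poly_growth_ext poly_growth_zz _ => n.
by rewrite !ger0_norm ?QQ_ge0 ?QQ_le ?(ltW (zz_gt0 _)).
Qed.

Lemma poly_growth_nat : poly_growth (fun n => n%:R : R).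
Proof.
exists 1, 1%N => n; rewrite expr1 mul1r ger0_norm// ler_nat//.
Qed.

Lemma poly_growth_unshift (c : nat -> R) x : poly_growth c ->
  poly_growth (fun n => if n is m.+1 then c m else x).
Proof.
move=> [C [m h]]; exists (`|C| + `|x|), m; case=> [|n] /=.
  by rewrite expr1n mulr1 lerDr.
apply: le_trans (h n) _; rewrite mulrDl -[leLHS]addr0 lerD ?mulr_ge0 ?exprn_ge0//.
apply: le_trans (ler_wpM2r _ (ler_norm C)) _; first by rewrite exprn_ge0.
by rewrite ler_wpM2l// lerXn2r ?nnegrE// ler_nat.
Qed.

Lemma tame_CC K : tame (axis R) K (fun n p => CC n (cT p)).
Proof. exact: tame_comp coordinate_cT (poly_growth_unshift 0 poly_growth_slo) step_Cb1. Qed.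

Lemma cT_KW n p : KW n p -> 0 < cT p <= 1.
Proof.
move=> /andP[h1 h2]; rewrite (lt_le_trans (aa_gt0 _) h1) /=.
exact: le_trans h2 (aa_le1 _).
Qed.

Lemma tame_cT : tame (axis R) KW (fun _ p => cT p).
Proof.
have h := @tame_lin R E3 'I_3 (axis R) KW cT (fun=> 1) (fun=> 0)
  coordinate_cT (poly_growth_const 1).
apply: tame_ext (h _) _; last by move=> n p; rewrite mul1r addr0.
apply: (@poly_bounded_bounded _ _ _ _ 1) => n p /cT_KW/andP[h1 h2].
by rewrite mul1r addr0 ger0_norm// ltW.
Qed.

Definition amp n : R := expR (- n%:R).

Lemma poly_bounded_expR K (F : nat -> E3 -> R) C : (forall n p, K n p -> F n p <= C) ->
  poly_bounded K (fun n p => expR (F n p)).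
Proof.
move=> h; apply: (@poly_bounded_bounded _ _ _ _ (expR C)) => n p Kp.
by rewrite ger0_norm ?expR_ge0// ler_expR h.
Qed.

(** The rapid factor [amp n] is split off, which leaves an exponent bounded above: by [phase_v] for
    n > 0, and thanks to the cutoff [th] for n = 0. *)
Lemma glueable_V : glueable (axis R) cT (fun n => aa n.-1)
  (fun n p => amp n * ((1 - SS 2 n (cT p)) * CC n (cT p) *
     expR (n%:R + (zz n * th (cT p) - QQ n)) * cos (kk n * cX p))).
Proof.
apply: (@glueable_moderate _ _ _ _ _ _ KV _ amp (fun n => aa n.+1)).
- apply: tame_moderate; apply: tame_mul; last exact: tame_trig coordinate_cX Cb1_cos poly_growth_kk.
  apply: tame_mul.
    apply: tame_mul; last exact: tame_CC.
    by apply: tame_sub; [exact: tame_const|exact: tame_SS].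
  apply: tame_exp.
    apply: tame_add; first exact: tame_cst poly_growth_nat.
    apply: tame_sub; last exact: tame_cst poly_growth_QQ.
    apply: (@tame_mul _ _ _ _ _ (fun n _ => zz n)); first exact: tame_cst poly_growth_zz.
    have h := tame_comp KV (fun=> 0) coordinate_cT (poly_growth_const 1) Cb1_th.
    by apply: tame_ext h _ => n p; rewrite mul1r addr0.
  have [C hC] := th_bounded.
  have C0 : 0 <= C by apply: le_trans (hC 0).
  (* The 1 is the index shift in [phase_v], which bounds mode n.+1 by expR (- n); the other summand
     is for mode 0. *)
  apply: (@poly_bounded_expR _ _ (1 + zz 0 * C)); case=> [|n] p.
    move=> _; rewrite add0r.
    have h : zz 0 * th (cT p) <= zz 0 * C.
      by rewrite ler_wpM2l ?(ltW (zz_gt0 _))//; apply: le_trans (hC (cT p)); exact: ler_norm.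
    by have := QQ_ge0 0; lra.
  move=> [h1 /(_ isT) /= h2].
  rewrite th_id; last first.
    rewrite (le_trans (ltW (aa_gt0 _)) h1) /=; exact: le_trans h2 (aa_le1 _).
  have := phase_v h2; have : 0 <= zz 0 * C by rewrite mulr_ge0// ltW// zz_gt0.
  rewrite -natr1; set a := zz 0 * C; set b := zz n.+1 * _ - _; lra.
- exact: rapid_nat.
- exact: closed_KV.
- move=> n p Kp; have [h1|h1] := ltP (cT p) (aa n.+1).
    rewrite SS1 ?subrr ?mul0r//.
    by move: h1; rewrite ltNge -tau_le1 -ltNge; lra.
  case: n Kp h1 => [|n] Kp h1; first by exfalso; apply: Kp.
  have h2 : aa n < cT p.
    by rewrite ltNge; apply/negP => h; apply: Kp; split.
  rewrite /CC /= argE step_le0 ?mulr0 ?mul0r//.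
  by move: h2; rewrite ltNge -tau_ge0 -ltNge; lra.
- by move=> n; exact: aa_gt0.
- exact: poly_growth_shift poly_growth_aaV.
- by move=> n p [].
- by move=> n p n1 [_]; apply.
Qed.

Lemma KW_out n p : ~ KW n p -> tau n (cT p) < 0 \/ 1 < tau n (cT p).
Proof.
move=> Kp; have [h1|h1] := ltP (cT p) (aa n.+1).
  by right; rewrite ltNge tau_le1 -ltNge.
have [h2|h2] := ltP (aa n) (cT p).
  by left; rewrite ltNge tau_ge0 -ltNge.
by exfalso; apply: Kp; apply/andP.
Qed.

Lemma glueable_KW (G : nat -> E3 -> R) (d : nat -> R) : tame (axis R) KW G -> rapid d ->
  (forall n p, tau n (cT p) <= 0 \/ 1 <= tau n (cT p) -> G n p = 0) ->
  glueable (axis R) cT (fun n => aa n.-1) (fun n p => d n * G n p).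
Proof.
move=> aG rd G0.
apply: (@glueable_moderate _ _ _ _ _ _ KW _ d (fun n => aa n.+1)) => //.
- exact: tame_moderate.
- exact: closed_KW.
- by move=> n p /KW_out h; apply: G0; case: h => /ltW; [left|right].
- by move=> n; exact: aa_gt0.
- exact: poly_growth_shift poly_growth_aaV.
- by move=> n p /andP[].
- move=> n p n1 /andP[_ h]; apply: le_trans h _.
  by apply: aa_le; rewrite leq_pred.
Qed.

Lemma glueable_W : glueable (axis R) cT (fun n => aa n.-1)
  (fun n p => amp n * ((SS 0 n (cT p) - SS 4 n (cT p)) *
     expR (n%:R + (zz n * cT p - QQ n + JJ n (cT p) * pp n)) * cos (kk n * cY p))).
Proof.
apply: glueable_KW; last 2 first.
- exact: rapid_nat.
- move=> n p [h|h]; first by rewrite !SS0 ?subrr ?mul0r//; lra.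
  by rewrite !SS1 ?subrr ?mul0r//; lra.
apply: tame_mul; last exact: tame_trig coordinate_cY Cb1_cos poly_growth_kk.
apply: tame_mul; first by apply: tame_sub; exact: tame_SS.
apply: tame_exp.
  apply: tame_add; first exact: tame_cst poly_growth_nat.
  apply: tame_add.
    apply: tame_sub; last exact: tame_cst poly_growth_QQ.
    by apply: (@tame_mul _ _ _ _ _ (fun n _ => zz n));
      [exact: tame_cst poly_growth_zz|exact: tame_cT].
  apply: (@tame_mul _ _ _ _ _ _ (fun n _ => pp n)); last exact: tame_cst poly_growth_pp.
  apply: tame_add; first exact: tame_const.
  apply: tame_mul; first exact: tame_const.
  by apply: tame_sub; exact: tame_SS.
have Jp n p : JJ n (cT p) * pp n <= 2 * pp n by rewrite ler_wpM2r ?JJ_le2// ltW// pp_gt0.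
apply: (@poly_bounded_expR _ _ (1 + 2 * pp 0)); case=> [|n] p /andP[h1 h2].
  have h : zz 0 * cT p <= QQ 0 by rewrite /= ler_wpM2l// ltW// zz_gt0.
  by rewrite add0r; have := Jp 0%N p; lra.
have := phase_w h2; have := Jp n.+1 p; have := pp_gt0 0.
rewrite -natr1; lra.
Qed.

Lemma glueable_UU : glueable (axis R) cT (fun n => aa n.-1) UU.
Proof.
have := glueable_add glueable_V glueable_W; congr glueable; apply/funext => n; apply/funext => p.
rewrite /amp /UU /gV /gW /Ev /Ew; set a := expR (- _).
have aK x : a * expR (n%:R + x) = expR x by rewrite /a -expRD addKr.
rewrite -[expR (zz n * th _ - _)]aK -[expR (_ + JJ _ _ * _)]aK; ring.
Qed.

(** * Coefficients absorbing the errors of the switches *)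

Definition cx n p : R := cos (kk n * cX p).
Definition cx' n p : R := cos (kk n.+1 * cX p).
Definition cy n p : R := cos (kk n * cY p).
Definition sx n p : R := sin (kk n * cX p).
Definition sx' n p : R := sin (kk n.+1 * cX p).
Definition sy n p : R := sin (kk n * cY p).

(** [XX] is the ratio of mode n.+1 to mode n ([EES]), [ep] its value at the lower end of the strip,
    and [YY] is ep / XX. At the third switch the auxiliary wave, of size ep^2 relative to mode n,
    has size ep * YY relative to mode n.+1. *)
Definition ep n : R := expR (- pp n).
Definition XX n t : R := expR (- (pp n * tau n t)).
Definition YY n t : R := expR (pp n * (tau n t - 1)).

(* [ep n * H1], [ep n * H2], [ep n * H3] are the factors gamma for the three
   switches: the auxiliary wave enters, mode [n.+1] replaces mode [n], the
   auxiliary wave leaves. *)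
Definition D1 n p := 1 + ep n * ep n * (SS 0 n (cT p) * (cy n p * cx n p)).
Definition H1 n p := ep n * (dS 0 n (cT p) * cy n p) / D1 n p.
Definition D2 n p := 1 + ep n * ep n *
  (((1 - SS 2 n (cT p)) * cx n p + SS 2 n (cT p) * XX n (cT p) * cx' n p) * cy n p).
Definition H2 n p :=
  ep n * (dS 2 n (cT p) * (XX n (cT p) * cx' n p - cx n p)) / D2 n p.
Definition D3 n p := 1 + ep n *
  ((1 - SS 4 n (cT p)) * YY n (cT p) * (cy n p * cx' n p)).
Definition H3 n p := - (dS 4 n (cT p) * YY n (cT p) * cy n p) / D3 n p.

Lemma half_le (x y : R) : 0 <= x <= 1 / 2 -> `|y| <= 1 -> 1 / 2 <= 1 + x * y.
Proof.
move=> /andP[x0 x1] y1; have : `|x * y| <= 1 / 2.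
  by rewrite normrM (ger0_norm x0) -[leRHS]mulr1 ler_pM.
by rewrite ler_norml => /andP[h _]; lra.
Qed.

Lemma ep_half n : 0 <= ep n <= 1 / 2.
Proof. by rewrite expR_ge0 expR_pp. Qed.

Lemma ep2_half n : 0 <= ep n * ep n <= 1 / 2.
Proof.
have /andP[h1 h2] := ep_half n; rewrite mulr_ge0//=.
have h3 : ep n <= 1 by lra.
by apply: le_trans h2; exact: ler_piMr.
Qed.

Lemma normM_le1 (x y : R) : `|x| <= 1 -> `|y| <= 1 -> `|x * y| <= 1.
Proof. by move=> h1 h2; rewrite normrM mulr_ile1. Qed.

Lemma SS_norm j n t : `|SS j n t| <= 1.
Proof. by rewrite ger0_norm ?SS_ge0 ?SS_le1. Qed.

(** Outside the strip [XX] exceeds 1 on the side tau < 0, where [SS 2] vanishes; [SSYY] is the same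
    remark for tau > 1. So the denominators are bounded below at every point and not only in the
    strip, as [tame_inv_half] requires. *)
Lemma SSXX n t : 0 <= SS 2 n t * XX n t <= SS 2 n t.
Proof.
rewrite mulr_ge0 ?SS_ge0 ?expR_ge0//=.
have [h|h] := leP (5 * tau n t) 2; first by rewrite SS0// mul0r.
rewrite ler_piMr ?SS_ge0// -expR0 ler_expR oppr_le0 mulr_ge0 ?(ltW (pp_gt0 _))//.
by lra.
Qed.

Lemma SSYY n t : `|(1 - SS 4 n t) * YY n t| <= 1.
Proof.
have [h|h] := leP 5 (5 * tau n t); first by rewrite SS1// subrr mul0r normr0.
apply: normM_le1.
  by rewrite ger0_norm ?subr_ge0 ?SS_le1//; have := SS_ge0 4 n t; lra.
rewrite ger0_norm ?expR_ge0// -expR0 ler_expR mulr_ge0_le0 ?(ltW (pp_gt0 _))//.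
by lra.
Qed.

Lemma D1_ge n p : 1 / 2 <= D1 n p.
Proof.
apply: half_le; first exact: ep2_half.
apply: normM_le1; first exact: SS_norm.
by apply: normM_le1; exact: cos_max.
Qed.

Lemma D2_ge n p : 1 / 2 <= D2 n p.
Proof.
apply: half_le; first exact: ep2_half.
apply: normM_le1; last exact: cos_max.
have /andP[h1 h2] := SSXX n (cT p).
have h3 : 0 <= 1 - SS 2 n (cT p) by rewrite subr_ge0 SS_le1.
apply: le_trans (ler_normD _ _) _.
rewrite [`|_ * cx n p|]normrM [`|_ * cx' n p|]normrM (ger0_norm h1) (ger0_norm h3).
have a1 : (1 - SS 2 n (cT p)) * `|cx n p| <= 1 - SS 2 n (cT p).
  by rewrite ler_piMr// cos_max.
have a2 : SS 2 n (cT p) * XX n (cT p) * `|cx' n p| <= SS 2 n (cT p) * XX n (cT p).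
  by rewrite ler_piMr// cos_max.
by lra.
Qed.

Lemma D3_ge n p : 1 / 2 <= D3 n p.
Proof.
apply: half_le; first exact: ep_half.
apply: normM_le1; first exact: SSYY.
by apply: normM_le1; exact: cos_max.
Qed.

Lemma tame_inv_half K (F : nat -> E3 -> R) : tame (axis R) K F ->
  (forall n p, 1 / 2 <= F n p) -> tame (axis R) K (fun n p => (F n p)^-1).
Proof.
move=> aF h; have h0 n p : 0 < F n p by apply: lt_le_trans (h n p).
apply: tame_inv => //; first by move=> n p; rewrite gt_eqF.
apply: (@poly_bounded_bounded _ _ _ _ 2) => n p _.
rewrite ger0_norm ?invr_ge0 ?(ltW (h0 _ _))//.
rewrite -[leRHS]invrK lef_pV2 ?posrE ?invr_gt0//.
by apply: le_trans (h n p); lra.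
Qed.

Lemma tame_cx K : tame (axis R) K cx.
Proof. exact: tame_trig coordinate_cX Cb1_cos poly_growth_kk. Qed.
Lemma tame_cx' K : tame (axis R) K cx'.
Proof. exact: tame_trig coordinate_cX Cb1_cos (poly_growth_shift poly_growth_kk). Qed.
Lemma tame_cy K : tame (axis R) K cy.
Proof. exact: tame_trig coordinate_cY Cb1_cos poly_growth_kk. Qed.
Lemma tame_sx K : tame (axis R) K sx.
Proof. exact: tame_trig coordinate_cX Cb1_sin poly_growth_kk. Qed.
Lemma tame_sx' K : tame (axis R) K sx'.
Proof. exact: tame_trig coordinate_cX Cb1_sin (poly_growth_shift poly_growth_kk). Qed.
Lemma tame_sy K : tame (axis R) K sy.
Proof. exact: tame_trig coordinate_cY Cb1_sin poly_growth_kk. Qed.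

Lemma tame_ep K : tame (axis R) K (fun n _ => ep n).
Proof.
apply: tame_cst; exists 1, 0%N => n; rewrite expr0 mulr1.
by have /andP[h1 h2] := ep_half n; rewrite ger0_norm//; lra.
Qed.

Lemma tame_tau : tame (axis R) KW (fun n p => tau n (cT p)).
Proof.
have h : tame (axis R) KW (fun n p => (slo n * cT p + off n 0)).
  apply: tame_lin; [exact: coordinate_cT|exact: poly_growth_slo|].
  apply: (@poly_bounded_bounded _ _ _ _ 5) => n p /andP[h1 h2].
  rewrite argE; move: h1 h2; rewrite -tau_ge0 -tau_le1 => h1 h2.
  by rewrite ler_norml; apply/andP; split; lra.
apply: tame_ext (tame_mul (tame_const _ _ 5^-1) h) _ => n p.
by rewrite argE subr0 mulKf.
Qed.

Lemma tame_XX : tame (axis R) KW (fun n p => XX n (cT p)).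
Proof.
apply: tame_exp.
  apply: tame_neg; apply: (@tame_mul _ _ _ _ _ (fun n _ => pp n)).
    exact: tame_cst poly_growth_pp.
  exact: tame_tau.
apply: (@poly_bounded_expR _ _ 0) => n p /andP[h1 h2].
by rewrite oppr_le0 mulr_ge0 ?(ltW (pp_gt0 _))// tau_ge0.
Qed.

Lemma tame_YY : tame (axis R) KW (fun n p => YY n (cT p)).
Proof.
apply: tame_exp.
  apply: (@tame_mul _ _ _ _ _ (fun n _ => pp n)); first exact: tame_cst poly_growth_pp.
  by apply: tame_sub; [exact: tame_tau|exact: tame_const].
apply: (@poly_bounded_expR _ _ 0) => n p /andP[h1 h2].
by rewrite mulr_ge0_le0 ?(ltW (pp_gt0 _))// subr_le0 tau_le1.
Qed.

Lemma tame_ep2 K : tame (axis R) K (fun n _ => ep n * ep n).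
Proof. by apply: (tame_mul (tame_ep K) (tame_ep K)). Qed.

Lemma tame_H1 : tame (axis R) KW H1.
Proof.
apply: tame_mul.
  apply: tame_mul; first exact: tame_ep.
  by apply: tame_mul; [exact: tame_dS|exact: tame_cy].
apply: tame_inv_half; last exact: D1_ge.
apply: tame_add; first exact: tame_const.
apply: tame_mul; first exact: tame_ep2.
by apply: tame_mul; [exact: tame_SS|apply: tame_mul; [exact: tame_cy|exact: tame_cx]].
Qed.

Lemma tame_H2 : tame (axis R) KW H2.
Proof.
apply: tame_mul.
  apply: tame_mul; first exact: tame_ep.
  apply: tame_mul; first exact: tame_dS.
  apply: tame_sub; last exact: tame_cx.
  by apply: tame_mul; [exact: tame_XX|exact: tame_cx'].
apply: tame_inv_half; last exact: D2_ge.
apply: tame_add; first exact: tame_const.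
apply: tame_mul; first exact: tame_ep2.
apply: tame_mul; last exact: tame_cy.
apply: tame_add; apply: tame_mul; [|exact: tame_cx| |exact: tame_cx'].
  by apply: tame_sub; [exact: tame_const|exact: tame_SS].
by apply: tame_mul; [exact: tame_SS|exact: tame_XX].
Qed.

Lemma tame_H3 : tame (axis R) KW H3.
Proof.
apply: tame_mul.
  apply: tame_neg; apply: tame_mul; last exact: tame_cy.
  by apply: tame_mul; [exact: tame_dS|exact: tame_YY].
apply: tame_inv_half; last exact: D3_ge.
apply: tame_add; first exact: tame_const.
apply: tame_mul; first exact: tame_ep.
apply: tame_mul; last by apply: tame_mul; [exact: tame_cy|exact: tame_cx'].
apply: tame_mul; last exact: tame_YY.
by apply: tame_sub; [exact: tame_const|exact: tame_SS].
Qed.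

Definition B1 n p := H1 n p * sx n p / kk n + H3 n p * sx' n p / kk n.+1.
Definition B2 n p := H2 n p * sy n p / kk n.
Definition B3 n p := - (H1 n p * cx n p + H2 n p * cy n p + H3 n p * cx' n p).

Lemma HH_out n p : tau n (cT p) <= 0 \/ 1 <= tau n (cT p) ->
  [/\ H1 n p = 0, H2 n p = 0 & H3 n p = 0].
Proof.
move=> h; have d j : (j <= 4)%N -> dS j n (cT p) = 0.
  move=> j4; have h4 : (j.+1%:R <= 5 :> R) by rewrite ler_nat.
  case: h => h; [apply: dS0|apply: dS1; lra].
  by apply: le_trans (ler0n _ _); lra.
by rewrite /H1 /H2 /H3 !d// !mul0r !mulr0 !oppr0 !mul0r.
Qed.

Lemma glueable_B1 : glueable (axis R) cT (fun n => aa n.-1) (fun n p => ep n * B1 n p).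
Proof.
apply: glueable_KW; last 2 first.
- exact: rapid_pp.
- by move=> n p /HH_out[h1 h2 h3]; rewrite /B1 h1 h3 !mul0r addr0.
apply: tame_add.
  apply: tame_mul; last exact: tame_cst poly_growth_kkV.
  by apply: tame_mul; [exact: tame_H1|exact: tame_sx].
apply: tame_mul; last exact: tame_cst (poly_growth_shift poly_growth_kkV).
by apply: tame_mul; [exact: tame_H3|exact: tame_sx'].
Qed.

Lemma glueable_B2 : glueable (axis R) cT (fun n => aa n.-1) (fun n p => ep n * B2 n p).
Proof.
apply: glueable_KW; last 2 first.
- exact: rapid_pp.
- by move=> n p /HH_out[h1 h2 h3]; rewrite /B2 h2 !mul0r.
apply: tame_mul; last exact: tame_cst poly_growth_kkV.
by apply: tame_mul; [exact: tame_H2|exact: tame_sy].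
Qed.

Lemma glueable_B3 : glueable (axis R) cT (fun n => aa n.-1) (fun n p => ep n * B3 n p).
Proof.
apply: glueable_KW; last 2 first.
- exact: rapid_pp.
- by move=> n p /HH_out[h1 h2 h3]; rewrite /B3 h1 h2 h3 !mul0r !addr0 oppr0.
apply: tame_neg; apply: tame_add.
  apply: tame_add; apply: tame_mul; [exact: tame_H1|exact: tame_cx|exact: tame_H2|exact: tame_cy].
by apply: tame_mul; [exact: tame_H3|exact: tame_cx'].
Qed.

(** * The coefficient of the second derivative in x2 *)

Lemma bounded_setT (T : Type) (f : T -> R) (C : R) :
  (forall q, `|f q| <= C) -> [bounded f q | q in [set: T]].
Proof.
move=> h; exists C; split; first exact: num_real.
by move=> x Cx q _; apply: le_trans (h q) (ltW Cx).
Qed.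

(** For 0 < t <= aa 0, n.+1 is the least index m with aa m < t. For other t no strip is met and n =
    0 is a default value. *)
Lemma strip_pick t : exists n,
  (forall m, m != n -> tau m t <= 0 \/ 1 <= tau m t) /\
  ((tau n t <= 0 \/ 1 <= tau n t) /\ (t <= 0 \/ aa 0 < t) \/ aa n.+1 < t <= aa n).
Proof.
have hi m : t <= aa m.+1 -> 1 <= tau m t by rewrite leNgt -tau_lt1 -leNgt.
have lo m : aa m <= t -> tau m t <= 0 by rewrite [in X in X -> _]leNgt -tau_gt0 -leNgt.
have [t0|t0] := leP t 0.
  exists 0%N; have h m : 1 <= tau m t by apply: hi; apply: le_trans t0 (ltW (aa_gt0 _)).
  by split; [move=> m _; right|left; split; [right|left]].
have [t1|t1] := ltP (aa 0) t.
  exists 0%N.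
  have h m : tau m t <= 0 by apply: lo; apply: le_trans (aa_le (leq0n m)) (ltW t1).
  by split; [move=> m _; left|left; split; [left|right]].
have ex : exists m, aa m < t by have [M hM] := aa_cvg0 t0; exists M; exact: hM.
case: (ex_minnP ex) => -[|n] hn mn; first by move: hn; rewrite ltNge t1.
have tn : t <= aa n by rewrite leNgt; apply/negP => /mn; rewrite ltnn.
exists n; split; last by right; rewrite hn.
move=> m; rewrite neq_ltn => /orP[h|h].
  by right; apply: hi; apply: le_trans tn (aa_le h).
by left; apply: lo; apply: le_trans (aa_le h) (ltW hn).
Qed.

(** Chosen so that the auxiliary wave satisfies its equation exactly where its cutoff is constant:
    its growth rate, [zz] plus [pp] times the derivative of [JJ], must equal l * zz. *)
Definition gl n t : R := 4 * pp n / zz n * (dS 1 n t - dS 3 n t).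
Definition ell t : R := 1 + glue gl t.

Lemma gl_out n t : tau n t <= 0 \/ 1 <= tau n t -> gl n t = 0.
Proof.
rewrite /gl => -[h|h]; first by rewrite !dS0 ?subrr ?mulr0//; lra.
by rewrite !dS1 ?subrr ?mulr0//; lra.
Qed.

Lemma glue_single (T : Type) (F : nat -> T -> R) (p : T) n :
  (forall m, m != n -> F m p = 0) -> glue F p = F n p.
Proof.
move=> h; rewrite (@glue_eq _ _ _ _ n.+1) => [|m nm]; last by rewrite h// gtn_eqF.
rewrite big_ord_recr /= big1 ?add0r// => i _.
by rewrite h// ltn_eqF.
Qed.

Lemma ell_pick t : exists n, ell t = 1 + gl n t /\ forall m, m != n -> gl m t = 0.
Proof.
have [n [hn _]] := strip_pick t; exists n.
have h m : m != n -> gl m t = 0 by move=> /hn; exact: gl_out.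
by rewrite /ell (glue_single h).
Qed.

Lemma glE n t : gl n t =
  - (20 * dl n) * (dstep (slo n * t + off n 1) - dstep (slo n * t + off n 3)).
Proof.
rewrite /gl /dS /slo /dl /pp; set A := dstep _; set B := dstep _.
have := rr_gt0 n; have := zz_gt0 n; move: (zz n) (zd n) (rr n) => z d r z0 r0.
by field; rewrite !gt_eqF.
Qed.

Definition ddstep : R -> R := locked (derive1 dstep).

Lemma Cb1_ddstep : Cb1 ddstep.
Proof. rewrite /ddstep -lock; exact: Cb1_derive1 Cb1_dstep. Qed.

Lemma is_derive_dstep (x : R) : is_derive x 1 dstep (ddstep x).
Proof. rewrite /ddstep -lock; exact: Cb1_is_derive Cb1_dstep. Qed.

Lemma dstep_bounded : exists C : R, forall x, `|dstep x| <= C.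
Proof. by have [_ [C h]] := Cb1_dstep 0%N; exists C. Qed.

Lemma ddstep_bounded : exists C : R, forall x, `|ddstep x| <= C.
Proof. by have [_ [C h]] := Cb1_ddstep 0%N; exists C. Qed.

Lemma dstep_lip : exists2 C : R, 0 <= C & forall x y, `|dstep x - dstep y| <= C * `|x - y|.
Proof.
have [C hC] := ddstep_bounded; exists C; first exact: le_trans (hC 0).
have h x y : y <= x -> `|dstep x - dstep y| <= C * `|x - y|.
  move=> yx; have [||c _ ->] := @MVT_segment R dstep ddstep y x yx.
  - by move=> z _; exact: is_derive_dstep.
  - by apply: derivable_within_continuous => z _; case: (is_derive_dstep z).
  - by rewrite normrM ler_wpM2r.
move=> x y; have [/h//|/ltW/h] := leP y x.
by rewrite distrC [`|y - x|]distrC.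
Qed.

Lemma min_powR (y al : R) : 0 <= y -> 0 < al < 1 -> Num.min 1 y <= y `^ al.
Proof.
move=> y0 /andP[a0 a1]; have [y1|y1] := leP 1 y.
  by rewrite -(powRr0 y); apply: ler_powR => //; exact: ltW.
move: y0; rewrite le_eqVlt => /orP[/eqP<-|y0]; first by rewrite powR_ge0.
by rewrite -[leLHS]powRr1 ?(ltW y0)//; apply: ger_powR; rewrite ?y0 ?ltW.
Qed.

(** The constant must not depend on n. An increment of [dstep] is O(min(1, |t - s| / r)) by
    boundedness and the Lipschitz bound, hence O((|t - s| / r)^al); the factor [dl n] * r^-al is
    bounded by [rr_holder]. *)
Lemma gl_holder al : 0 < al < 1 -> exists2 C, 0 <= C &
  forall n t s, `|gl n t - gl n s| <= C * `|t - s| `^ al.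
Proof.
move=> al01; have [L L0 hL] := dstep_lip; have [B hB] := dstep_bounded.
have B0 : 0 <= B by apply: le_trans (hB 0).
have [C hC] := rr_holder al01.
have C0 : 0 <= C.
  have := hC 0%N; rewrite leNgt => h; rewrite leNgt; apply/negP => Cn.
  move: h; rewrite -leNgt => h.
  have : 0 < C * rr 0 `^ al by apply: lt_le_trans h; rewrite invr_gt0 NN_gt0.
  by rewrite nmulr_rgt0// ltNge powR_ge0.
pose K := 2 * (5 * L + 2 * B); have K0 : 0 <= K.
  by rewrite mulr_ge0// addr_ge0 ?mulr_ge0.
exists (20 * K * (15 * C)); first by apply: mulr_ge0; apply: mulr_ge0.
move=> n t s.
have r0 := rr_gt0 n; have N0 := NN_gt0 n.
pose d j := dstep (slo n * t + off n j) - dstep (slo n * s + off n j).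
have hd j : `|d j| <= (5 * L + 2 * B) * Num.min 1 (`|t - s| / rr n).
  have q0 : 0 <= `|t - s| / rr n by rewrite divr_ge0// ltW.
  have h1 : `|d j| <= 5 * L * (`|t - s| / rr n).
    apply: le_trans (hL _ _) _.
    have -> : slo n * t + off n j - (slo n * s + off n j) = (- 5 / rr n) * (t - s).
      by rewrite /slo; ring.
    rewrite normrM normrM normrN normfV (ger0_norm (ltW r0)) (@ger0_norm _ 5)//.
    by rewrite le_eqVlt; apply/orP; left; apply/eqP; ring.
  have h2 : `|d j| <= 2 * B.
    apply: le_trans (ler_normB _ _) _; have := hB (slo n * t + off n j).
    by have := hB (slo n * s + off n j); move: (`|_|) (`|_|) => a b; lra.
  have [y1|y1] := leP 1 (`|t - s| / rr n).
    by rewrite mulr1; apply: le_trans h2 _; rewrite lerDr mulr_ge0.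
  apply: le_trans h1 _; rewrite ler_wpM2r// lerDl mulr_ge0//.
have -> : gl n t - gl n s = - (20 * dl n) * (d 1%N - d 3%N).
  by rewrite !glE /d; ring.
rewrite normrM normrN (ger0_norm (mulr_ge0 _ (ltW (dl_gt0 n))))//.
have h3 : `|d 1%N - d 3%N| <= K * Num.min 1 (`|t - s| / rr n).
  apply: le_trans (ler_normB _ _) _; have := hd 1%N; have := hd 3%N.
  rewrite /K -mulrA; set Z := _ * Num.min _ _; lra.
have h4 : Num.min 1 (`|t - s| / rr n) <= `|t - s| `^ al * (rr n `^ al)^-1.
  apply: le_trans (min_powR _ al01) _; first by rewrite divr_ge0// ltW.
  by rewrite powRM ?invr_ge0 ?(ltW r0)// -(powR_inv1 (ltW r0)) -powRrM mulN1r powRN.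
have h5 : dl n * (rr n `^ al)^-1 <= 15 * C.
  rewrite ler_pdivrMr ?powR_gt0//; apply: le_trans (dl_le n) _.
  by rewrite -mulrA ler_wpM2l.
apply: (@le_trans _ _ (20 * dl n * (K * (`|t - s| `^ al * (rr n `^ al)^-1)))).
  apply: ler_wpM2l; first by rewrite mulr_ge0// ltW// dl_gt0.
  by apply: le_trans h3 _; exact: ler_wpM2l.
have -> : 20 * dl n * (K * (`|t - s| `^ al * (rr n `^ al)^-1)) =
  20 * K * (dl n * (rr n `^ al)^-1) * `|t - s| `^ al by ring.
by rewrite ler_wpM2r ?powR_ge0// ler_wpM2l// mulr_ge0.
Qed.

(** When t and s pick different strips, each of the two terms is compared with its own value 0 at
    the other point, which doubles the constant. *)
Lemma ell_holder al : 0 < al < 1 -> exists2 C, 0 <= C &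
  forall t s, `|ell t - ell s| <= C * `|t - s| `^ al.
Proof.
move=> /gl_holder[C C0 hC]; exists (C + C); first by rewrite addr_ge0.
move=> t s; have [n [-> hn]] := ell_pick t; have [m [-> hm]] := ell_pick s.
rewrite addrAC opprD addrA subrr add0r addrC.
have [<-|nm] := eqVneq n m.
  apply: le_trans (hC n t s) _; rewrite ler_wpM2r ?powR_ge0// lerDl//.
have -> : gl n t - gl m s = (gl n t - gl n s) + (gl m t - gl m s).
  by rewrite (hm n)// (hn m) 1?eq_sym// subr0 sub0r.
by apply: le_trans (ler_normD _ _) _; rewrite mulrDl lerD.
Qed.

Lemma ell_continuous : continuous ell.
Proof.
have [C C0 hC] := @ell_holder (2^-1) ltac:(by apply/andP; split; lra).
move=> t; apply/cvgrPdist_le => eps e0.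
have C1 : 0 < C + 1 by rewrite ltr_wpDl.
pose d := (eps / (C + 1)) ^+ 2.
have d0 : 0 < d by rewrite exprn_gt0// divr_gt0.
near=> s.
have hs : `|t - s| <= d by near: s; exists d => // s /= h; exact: ltW.
apply: le_trans (hC _ _) _.
have h : `|t - s| `^ 2^-1 <= eps / (C + 1).
  rewrite powR12_sqrt//; have e1 : 0 <= eps / (C + 1) by rewrite divr_ge0 ?ltW.
  have -> : eps / (C + 1) = Num.sqrt d by rewrite sqrtr_sqr ger0_norm.
  exact: ler_wsqrtr.
apply: le_trans (ler_wpM2l C0 h) _.
rewrite mulrA ler_pdivrMr// mulrC ler_wpM2l ?(ltW e0)// lerDl//.
Unshelve. all: by end_near. Qed.

(** The deviation from 1 is at most 20 * (15 / N) * 2 B = 600 B / N, hence at most 1/2 once N >=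
    1200 B. *)
Lemma ell_bounds (B : R) t : (forall x, `|dstep x| <= B) -> 1200 * B <= n0%:R ->
  1 / 2 <= ell t <= 3 / 2.
Proof.
move=> hB Bn; have [n [-> _]] := ell_pick t.
have B0 : 0 <= B by apply: le_trans (hB 0).
suff : `|gl n t| <= 1 / 2 by rewrite ler_norml => /andP[h1 h2]; apply/andP; split; lra.
rewrite glE normrM normrN (ger0_norm (mulr_ge0 _ (ltW (dl_gt0 n))))//.
apply: (@le_trans _ _ (20 * (15 / NN n) * (2 * B))).
  apply: ler_pM => //; first by rewrite mulr_ge0// ltW// dl_gt0.
    by rewrite ler_wpM2l// dl_le.
  apply: le_trans (ler_normB _ _) _; have := hB (slo n * t + off n 1).
  by have := hB (slo n * t + off n 3); move: (`|_|) (`|_|) => a b; lra.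
have -> : 20 * (15 / NN n) * (2 * B) = 600 * B / NN n by ring.
rewrite ler_pdivrMr ?NN_gt0//.
have : n0%:R <= NN n by rewrite ler_nat leq_addr.
by lra.
Qed.

Lemma ell_C0_alpha (B : R) al : (forall x, `|dstep x| <= B) -> 1200 * B <= n0%:R ->
  0 <= al < 1 -> C0_alpha al ell.
Proof.
move=> hB Bn /andP[a0 a1]; split.
  apply: (@bounded_setT _ _ (3 / 2)) => t; have /andP[h1 h2] := ell_bounds t hB Bn.
  by rewrite ger0_norm//; lra.
case: eqVneq => [_|an0]; first exact: ell_continuous.
have [|C C0 hC] := @ell_holder al; first by rewrite a1 lt_neqAle eq_sym an0 a0.
exists C => _ [t [s [/andP[h0 _] ->]]].
by rewrite ler_pdivrMr ?powR_gt0.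
Qed.

Lemma ell_near t : t != 0 ->
  exists M, \forall s \near t, ell s = 1 + \sum_(i < M) gl i s.
Proof.
rewrite neq_lt => /orP[t0|t0].
  exists 0%N; near=> s.
  have s0 : s < 0 by near: s; exact: lt_nbhsl.
  rewrite big_ord0 /ell (@glue_eq _ _ _ _ 0%N) ?big_ord0// => n _.
  by apply: gl_out; right; rewrite leNgt tau_lt1 -leNgt (le_trans (ltW s0))// ltW// aa_gt0.
have t2 : t / 2 < t by lra.
have [|M hM] := @aa_cvg0 (t / 2); first by lra.
exists M; near=> s; rewrite /ell (@glue_eq _ _ _ _ M)// => n Mn.
apply: gl_out; left; rewrite leNgt tau_gt0 -leNgt; apply/ltW.
apply: lt_trans (hM n Mn) _; near: s; exact: lt_nbhsr.
Unshelve. all: by end_near. Qed.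

Lemma tame_gl i : tame (@unit_dir R) (fun=> setT) (fun=> gl i).
Proof.
apply: tame_mul; first exact: (@tame_const _ _ _ _ _ (4 * pp i / zz i)).
have h j : tame (@unit_dir R) (fun=> setT) (fun=> dS j i).
  apply: tame_mul; first exact: (@tame_const _ _ _ _ _ (slo i)).
  exact: (tame_comp (fun=> setT) (fun=> off i j) (@coordinate_id R)
    (poly_growth_const (slo i)) Cb1_dstep).
by apply: tame_sub; exact: h.
Qed.

Lemma tame_sum_gl M : tame (@unit_dir R) (fun=> setT) (fun _ s => 1 + \sum_(i < M) gl i s).
Proof.
apply: tame_add; first exact: tame_const.
elim: M => [|M ih].
  by apply: tame_ext (tame_const _ _ 0) _ => _ s; rewrite big_ord0.
by apply: tame_ext (tame_add ih (tame_gl M)) _ => _ s; rewrite big_ord_recr.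
Qed.

Lemma near_derive1n (f g : R -> R) (t : R) j : (\forall s \near t, f s = g s) ->
  \forall s \near t, derive1n j f s = derive1n j g s.
Proof.
move=> h; elim: j => [//|j ih].
have := near_join ih; apply: filterS => s hs.
by rewrite !derive1nS !derive1E; apply: near_eq_derive.
Qed.

Lemma ell_smooth : smooth_on [set t : R | t != 0] ell.
Proof.
move=> j t /= t0; have [M hM] := ell_near t0.
have h := near_derive1n j hM.
apply: (@near_eq_derivable _ _ _ (derive1n j (fun s => 1 + \sum_(i < M) gl i s))).
  by apply: filterS h => s ->.
have [/(_ 0%N tt t) + _ _] := tame_moderate (tame_sum_gl M) (nseq j tt).
by rewrite iter_derive_unit_dir size_nseq.
Qed.

Definition dgl n t : R := - (20 * dl n) * slo n *
  (ddstep (slo n * t + off n 1) - ddstep (slo n * t + off n 3)).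

Lemma is_derive_gl n (t : R) : is_derive t 1 (gl n) (dgl n t).
Proof.
have -> : gl n = (fun t => - (20 * dl n) *
    (dstep (slo n * t + off n 1) - dstep (slo n * t + off n 3))).
  by apply/funext => s; exact: glE.
have h j : is_derive t 1 (fun t => dstep (slo n * t + off n j))
    (ddstep (slo n * t + off n j) * slo n).
  exact: (@is_derive_comp1 R R dstep (fun t => slo n * t + off n j) t 1 _ _
    (is_derive_dstep _) (is_derive_arg n j t)).
apply: is_derive_eq (is_deriveZ (- (20 * dl n)) (is_deriveB (h 1%N) (h 3%N))) _.
rewrite /dgl /GRing.scale /=; ring.
Qed.

Lemma ddstep_out x : x < 0 \/ 1 < x -> ddstep x = 0.
Proof.
move=> h; rewrite /ddstep -lock derive1E; apply: derive_zero_near; case: h => h.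
  by near=> y; apply: dstep_le0; apply/ltW; near: y; exact: lt_nbhsl.
by near=> y; apply: dstep_ge1; apply/ltW; near: y; exact: lt_nbhsr.
Unshelve. all: by end_near. Qed.

Lemma dgl_out n t : tau n t <= 0 \/ 1 <= tau n t -> dgl n t = 0.
Proof.
move=> h; rewrite /dgl !argE !ddstep_out ?subrr ?mulr0//; case: h => h.
- by left; lra.
- by right; lra.
- by left; lra.
- by right; lra.
Qed.

Lemma is_derive_ell (t : R) : t != 0 -> exists M, is_derive t 1 ell (\sum_(i < M) dgl i t).
Proof.
move=> t0; have [M hM] := ell_near t0; exists M.
apply: (@near_eq_is_derive _ _ _ (fun s => 1 + \sum_(i < M) gl i s)).
  by apply: filterS hM => s ->.
have hs : is_derive t 1 (fun s => \sum_(i < M) gl i s) (\sum_(i < M) dgl i t).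
  elim: M {hM} => [|M ih].
    under eq_fun do rewrite big_ord0; rewrite big_ord0; exact: is_derive_cst.
  under eq_fun do rewrite big_ord_recr; rewrite big_ord_recr /=.
  exact: (is_deriveD ih (is_derive_gl M t)).
have := is_deriveD (is_derive_cst (1 : R) t 1) hs.
by rewrite add0r.
Qed.

(** On the n-th strip at most [dgl n] is nonzero, and it is O(1 / (N r_n)). [rr_aa] converts this
    into a power of [aa n], and t <= aa n there. *)
Lemma ell_derive_bound eps : 0 < eps -> exists C : R, forall t : R, t != 0 ->
  `|derive1 ell t| <= C * `|t| `^ (- (1 + eps)).
Proof.
move=> e0; have [C C0 hC] := rr_aa e0; have [B hB] := ddstep_bounded.
have B0 : 0 <= B by apply: le_trans (hB 0).
exists (20 * 15 * 5 * (2 * B) * C) => t t0.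
have [M hM] := is_derive_ell t0.
have [n [hn hs]] := strip_pick t.
have -> : derive1 ell t = \sum_(i < M) dgl i t by rewrite derive1E; case: hM.
have h1 : `|\sum_(i < M) dgl i t| <= `|dgl n t|.
  have [nM|nM] := ltnP n M; last first.
    rewrite big1 ?normr0// => i _; apply: dgl_out; apply: hn.
    by rewrite ltn_eqF// (leq_trans (ltn_ord i)).
  rewrite (bigD1 (Ordinal nM))//= big1 ?addr0// => i hi.
  by apply: dgl_out; apply: hn.
apply: le_trans h1 _; case: hs => [[hs _]|/andP[h1 h2]].
  by rewrite dgl_out// normr0 !mulr_ge0 ?powR_ge0.
have tp : 0 < t by apply: lt_trans h1; exact: aa_gt0.
rewrite (ger0_norm (ltW tp)).
have h3 : `|dgl n t| <= 20 * 15 * 5 * (2 * B) * (NN n * rr n)^-1.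
  rewrite /dgl normrM [`|_ * slo n|]normrM normrN (ger0_norm (mulr_ge0 _ (ltW (dl_gt0 n))))//.
  have r0 := rr_gt0 n; have N0 := NN_gt0 n.
  have -> : `|slo n| = 5 / rr n.
    by rewrite /slo normrM normrN normfV (ger0_norm (ltW r0)) ger0_norm.
  have -> : 20 * 15 * 5 * (2 * B) * (NN n * rr n)^-1 =
    20 * (15 / NN n) * (5 / rr n) * (2 * B) by rewrite invfM; ring.
  apply: ler_pM => //.
    by apply: mulr_ge0; [rewrite mulr_ge0// ltW// dl_gt0|rewrite divr_ge0// ltW].
    apply: ler_pM => //.
    - by rewrite mulr_ge0 ?(ltW (dl_gt0 n)).
    - by rewrite divr_ge0 ?(ltW r0).
    - by rewrite ler_wpM2l ?dl_le.
  apply: le_trans (ler_normB _ _) _.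
  have := hB (slo n * t + off n 1); have := hB (slo n * t + off n 3).
  by move: (`|_|) (`|_|) => a b; lra.
apply: le_trans h3 _; rewrite -!mulrA !ler_wpM2l//.
apply: le_trans (hC n) _; rewrite ler_wpM2l//.
rewrite !powRN lef_pV2 ?posrE ?powR_gt0 ?aa_gt0//.
apply: ge0_ler_powR => //; rewrite ?nnegrE ?(ltW tp) ?(ltW (aa_gt0 _))//.
by rewrite addr_ge0// ltW.
Qed.

(** * The equation *)

Definition dth : R -> R := locked (derive1 th).

Lemma Cb1_dth : Cb1 dth.
Proof. rewrite /dth -lock; exact: Cb1_derive1 Cb1_th. Qed.

Lemma is_derive_th (x : R) : is_derive x 1 th (dth x).
Proof. rewrite /dth -lock; exact: Cb1_is_derive Cb1_th. Qed.

Lemma dthE x : 0 < x < 1 -> dth x = 1.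
Proof. by rewrite /dth -lock; exact: dth_id. Qed.

Definition dgV n t : R :=
  (- dS 2 n t * CC n t + (1 - SS 2 n t) * dC n t) * Ev n t +
  (1 - SS 2 n t) * CC n t * (zz n * dth t * Ev n t).

Definition dgW n t : R := (dS 0 n t - dS 4 n t) * Ew n t +
  (SS 0 n t - SS 4 n t) * ((zz n + 4 * (dS 1 n t - dS 3 n t) * pp n) * Ew n t).

Lemma is_derive_CC n (t : R) : is_derive t 1 (CC n) (dC n t).
Proof.
have h : is_derive t 1 (fun t : R => slo' n * t + off' n) (slo' n).
  by apply: is_derive_affine => x; rewrite /GRing.scale /=; ring.
have := @is_derive_comp1 R R (@step R) (fun t => slo' n * t + off' n) t 1 _ _
  (is_derive_step _) h.
by rewrite mulrC.
Qed.

Lemma is_derive_gV n (t : R) : is_derive t 1 (gV n) (dgV n t).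
Proof.
have h1 : is_derive t 1 (fun t => zz n * th t - QQ n) (zz n * dth t).
  apply: is_derive_eq (is_deriveB (is_deriveZ (zz n) (is_derive_th t))
    (is_derive_cst (QQ n) t 1)) _.
  by rewrite subr0.
have h2 : is_derive t 1 (Ev n) (Ev n t * (zz n * dth t)).
  exact: (@is_derive_comp1 R R expR (fun t => zz n * th t - QQ n) t 1 _ _
    (is_derive_expR _) h1).
have h3 : is_derive t 1 (fun t => 1 - SS 2 n t) (0 - dS 2 n t).
  exact: (is_deriveB (is_derive_cst (1 : R) t 1) (is_derive_SS 2 n t)).
have h4 : is_derive t 1 (fun t => (1 - SS 2 n t) * CC n t)
    ((1 - SS 2 n t) * dC n t + CC n t * (0 - dS 2 n t)).
  exact: (is_deriveM h3 (is_derive_CC n t)).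
apply: is_derive_eq (is_deriveM h4 h2) _.
by rewrite /dgV /GRing.scale /=; ring.
Qed.

Lemma is_derive_gW n (t : R) : is_derive t 1 (gW n) (dgW n t).
Proof.
have h0 : is_derive t 1 (fun t => zz n * t - QQ n) (zz n).
  by apply: is_derive_affine => x; rewrite /GRing.scale /=; ring.
have hJ : is_derive t 1 (JJ n) (4 * (dS 1 n t - dS 3 n t)).
  apply: is_derive_eq (is_deriveD (is_derive_cst (- 2 : R) t 1)
    (is_deriveZ 4 (is_deriveB (is_derive_SS 1 n t) (is_derive_SS 3 n t)))) _.
  by rewrite add0r.
have hJp : is_derive t 1 (fun t => JJ n t * pp n) (4 * (dS 1 n t - dS 3 n t) * pp n).
  apply: is_derive_eq (is_deriveM hJ (is_derive_cst (pp n) t 1)) _.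
  by rewrite /GRing.scale /= mulr0 add0r mulrC.
have h1 : is_derive t 1 (fun t => zz n * t - QQ n + JJ n t * pp n)
    (zz n + 4 * (dS 1 n t - dS 3 n t) * pp n).
  exact: (is_deriveD h0 hJp).
have h2 : is_derive t 1 (Ew n) (Ew n t * (zz n + 4 * (dS 1 n t - dS 3 n t) * pp n)).
  exact: (@is_derive_comp1 R R expR (fun t => zz n * t - QQ n + JJ n t * pp n) t 1 _ _
    (is_derive_expR _) h1).
have h3 : is_derive t 1 (fun t => SS 0 n t - SS 4 n t) (dS 0 n t - dS 4 n t).
  exact: (is_deriveB (is_derive_SS 0 n t) (is_derive_SS 4 n t)).
apply: is_derive_eq (is_deriveM h3 h2) _.
rewrite /dgW /GRing.scale /=; set a := Ew n t; set b := 4 * _ * _.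
by rewrite addrC [a * _]mulrC; congr (_ + _); rewrite [a * _]mulrC.
Qed.

Lemma is_derive_term (g h : R -> R) (k : R) (c : E3 -> R) (p v : E3)
    (dT dc g' h' : R) : is_derive p v cT dT -> is_derive p v c dc ->
  is_derive (cT p) 1 g g' -> is_derive (k * c p) 1 h h' ->
  is_derive p v (fun q => g (cT q) * h (k * c q))
    (g (cT p) * (h' * (k * dc)) + h (k * c p) * (g' * dT)).
Proof.
move=> hT hc hg hh.
have h1 := is_derive_comp1 hg hT.
have h2 : is_derive p v (fun q => h (k * c q)) (h' * (k * dc)).
  exact: (@is_derive_comp1 R _ h (fun q => k * c q) p v _ _ hh (is_deriveZ k hc)).
exact: (is_deriveM h1 h2).
Qed.

Lemma cT_dir (p v : E3) : is_derive p v cT v.1.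
Proof. by apply: is_derive_affine => h; rewrite /cT /= addrC. Qed.
Lemma cX_dir (p v : E3) : is_derive p v cX v.2.1.
Proof. by apply: is_derive_affine => h; rewrite /cX /= addrC. Qed.
Lemma cY_dir (p v : E3) : is_derive p v cY v.2.2.
Proof. by apply: is_derive_affine => h; rewrite /cY /= addrC. Qed.

Lemma UU_dir n (p v : E3) : is_derive p v (UU n)
  (gV n (cT p) * (- sx n p * (kk n * v.2.1)) + cx n p * (dgV n (cT p) * v.1) +
   (gW n (cT p) * (- sy n p * (kk n * v.2.2)) + cy n p * (dgW n (cT p) * v.1))).
Proof.
have h1 := is_derive_term (cT_dir p v) (cX_dir p v) (is_derive_gV n (cT p))
  (is_derive_cos (kk n * cX p)).
have h2 := is_derive_term (cT_dir p v) (cY_dir p v) (is_derive_gW n (cT p))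
  (is_derive_cos (kk n * cY p)).
exact: (is_deriveD h1 h2).
Qed.

Lemma UU_t n p : 'D_(et R) (UU n) p = dgV n (cT p) * cx n p + dgW n (cT p) * cy n p.
Proof. have [_ ->] := UU_dir n p (et R); rewrite /=; ring. Qed.

Lemma UU_x n p : 'D_(ex1 R) (UU n) p = - (kk n * gV n (cT p) * sx n p).
Proof. have [_ ->] := UU_dir n p (ex1 R); rewrite /=; ring. Qed.

Lemma UU_y n p : 'D_(ex2 R) (UU n) p = - (kk n * gW n (cT p) * sy n p).
Proof. have [_ ->] := UU_dir n p (ex2 R); rewrite /=; ring. Qed.

Lemma UU_xx n p : 'D_(ex1 R) ('D_(ex1 R) (UU n)) p = - (zz n * gV n (cT p) * cx n p).
Proof.
have -> : 'D_(ex1 R) (UU n) = (fun q => (- kk n) *: (gV n (cT q) * sin (kk n * cX q))).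
  by apply/funext => q; rewrite UU_x /sx /GRing.scale /=; ring.
have h := is_derive_term (cT_dir p (ex1 R)) (cX_dir p (ex1 R)) (is_derive_gV n (cT p))
  (is_derive_sin (kk n * cX p)).
have [_ ->] := is_deriveZ (- kk n) h.
by rewrite /GRing.scale /= -kk_sqr /cx; ring.
Qed.

Lemma UU_yy n p : 'D_(ex2 R) ('D_(ex2 R) (UU n)) p = - (zz n * gW n (cT p) * cy n p).
Proof.
have -> : 'D_(ex2 R) (UU n) = (fun q => (- kk n) *: (gW n (cT q) * sin (kk n * cY q))).
  by apply/funext => q; rewrite UU_y /sy /GRing.scale /=; ring.
have h := is_derive_term (cT_dir p (ex2 R)) (cY_dir p (ex2 R)) (is_derive_gW n (cT p))
  (is_derive_sin (kk n * cY p)).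
have [_ ->] := is_deriveZ (- kk n) h.
by rewrite /GRing.scale /= -kk_sqr /cy; ring.
Qed.

Definition uu : E3 -> R := glue UU.
Definition b1 : E3 -> R := glue (fun n p => ep n * B1 n p).
Definition b2 : E3 -> R := glue (fun n p => ep n * B2 n p).
(** The second term restores the equation for mode 0 at times where [th] is not the identity: its
    growth rate is then zz 0 * dth, while the second derivative still contributes - zz 0. *)
Definition cc p : R := glue (fun n p => ep n * B3 n p) p + zz 0 * (1 - dth (cT p)).

Lemma cT_continuous : continuous cT.
Proof. by have [] := coordinate_cT. Qed.

Lemma aa_pred_cvg0 eps : 0 < eps -> exists M, forall n, (M <= n)%N -> aa n.-1 < eps.
Proof.
move=> /aa_cvg0[M hM]; exists M.+1; case=> [//|n] Mn; exact: hM.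
Qed.

Lemma uu_iter_derive s p :
  iter_derive (axis R) s uu p = glue (fun n => iter_derive (axis R) s (UU n)) p.
Proof.
by rewrite /uu (iter_derive_glue cT_continuous cT_axis aa_pred_cvg0 s glueable_UU).
Qed.

Lemma Cb_infty_moderate (f : E3 -> R) :
  moderate (axis R) (fun=> setT) (fun=> f) -> Cb_infty f.
Proof.
move=> h s; have [d c [C [m b]]] := h s; split.
- by move=> i p; exact: (d 0%N i p).
- exact: (c 0%N).
- apply: (@bounded_setT _ _ C) => p.
  by have := b 0%N p Logic.I; rewrite expr1n mulr1.
Qed.

Let glue_smooth' F := @glue_smooth R E3 'I_3 (axis R) cT cT_continuous cT_axis
  (fun n => aa n.-1) aa_pred_cvg0 F.

Lemma Cb_uu : Cb_infty uu.
Proof. by apply: Cb_infty_moderate; apply: glue_smooth'; exact: glueable_UU. Qed.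

Lemma Cb_b1 : Cb_infty b1.
Proof. by apply: Cb_infty_moderate; apply: glue_smooth'; exact: glueable_B1. Qed.

Lemma Cb_b2 : Cb_infty b2.
Proof. by apply: Cb_infty_moderate; apply: glue_smooth'; exact: glueable_B2. Qed.

Lemma Cb_cc : Cb_infty cc.
Proof.
apply: Cb_infty_moderate; apply: (@moderate_add _ _ _ _ _ (fun=> glue _)).
  by apply: glue_smooth'; exact: glueable_B3.
apply: tame_moderate; apply: tame_mul; first exact: tame_const.
apply: tame_sub; first exact: tame_const.
have h := tame_comp (fun=> setT) (fun=> 0) coordinate_cT (poly_growth_const 1) Cb1_dth.
by apply: tame_ext h _ => n p; rewrite mul1r addr0.
Qed.

(** * The modes alive at a given time *)

Lemma gV_out n t : 1 <= tau n t -> gV n t = 0 /\ dgV n t = 0.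
Proof.
move=> h; have s : SS 2 n t = 1 by apply: SS1; lra.
have d : dS 2 n t = 0 by apply: dS1; lra.
by rewrite /gV /dgV s d; split; ring.
Qed.

Lemma gV_out' n t : tau n t <= 0 -> gV n.+1 t = 0 /\ dgV n.+1 t = 0.
Proof.
move=> h; have s : CC n.+1 t = 0 by apply: (@SS0 2 n); lra.
have d : dC n.+1 t = 0 by apply: (@dS0 2 n); lra.
by rewrite /gV /dgV s d; split; ring.
Qed.

Lemma gW_out n t : tau n t <= 0 \/ 1 <= tau n t -> gW n t = 0 /\ dgW n t = 0.
Proof.
move=> h; have [s d] : SS 0 n t = SS 4 n t /\ dS 0 n t = dS 4 n t.
  case: h => h; split.
  - by rewrite !SS0//; lra.
  - by rewrite !dS0//; lra.
  - by rewrite !SS1//; lra.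
  - by rewrite !dS1//; lra.
by rewrite /gW /dgW s d !subrr !mul0r addr0.
Qed.

Lemma aa_lt1 n : aa n < 1.
Proof. by rewrite -expR0 ltr_expR oppr_lt0 LL_gt0// NN_gt1. Qed.

Definition EE n t : R := expR (zz n * t - QQ n).

Lemma EvE n t : 0 < t < 1 -> Ev n t = EE n t.
Proof. by move=> /andP[h1 h2]; rewrite /Ev th_id// !ltW. Qed.

Lemma EES n t : EE n.+1 t = EE n t * XX n t.
Proof.
rewrite /EE /XX -expRD; congr expR; rewrite /= /pp /tau.
have := rr_gt0 n; move: (rr n) => r r0.
rewrite /zd; move: (zz n) (zz n.+1) => z z'.
by field; rewrite gt_eqF.
Qed.

Lemma strip_lt n t : aa n.+1 < t <= aa n -> [/\ 0 < t < 1, 0 <= tau n t < 1,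
  forall m, (m < n)%N -> 1 <= tau m t & forall m, (n < m)%N -> tau m t <= 0].
Proof.
move=> /andP[h1 h2]; split.
- by rewrite (lt_trans (aa_gt0 _) h1) (le_lt_trans h2 (aa_lt1 _)).
- by rewrite tau_ge0 tau_lt1 h1 h2.
- move=> m mn; rewrite leNgt tau_lt1 -leNgt; exact: le_trans h2 (aa_le mn).
- move=> m nm; rewrite leNgt tau_gt0 -leNgt; exact: le_trans (aa_le nm) (ltW h1).
Qed.

Lemma CC_strip n t (ht : aa n.+1 < t <= aa n) : CC n t = 1 /\ dC n t = 0.
Proof.
have [_ _ hm _] := strip_lt ht; case: n hm {ht} => [|m] hm.
  by rewrite /CC /dC /= !mul0r step_ge1//; lra.
have h := hm m (leqnn _); split; [apply: (@SS1 2 m)|apply: (@dS1 2 m)]; lra.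
Qed.

Lemma gV_strip n t (ht : aa n.+1 < t <= aa n) : gV n t = (1 - SS 2 n t) * EE n t /\
  dgV n t = (- dS 2 n t + (1 - SS 2 n t) * zz n) * EE n t.
Proof.
have [c d] := CC_strip ht; have [t01 _ _ _] := strip_lt ht.
by rewrite /gV /dgV c d EvE// dthE//; split; ring.
Qed.

Lemma gVS_strip n t (ht : aa n.+1 < t <= aa n) : gV n.+1 t = SS 2 n t * (EE n t * XX n t) /\
  dgV n.+1 t = (dS 2 n t + SS 2 n t * zz n.+1) * (EE n t * XX n t).
Proof.
have [t01 _ _ hn] := strip_lt ht; have h := hn _ (ltnSn n).
have s : SS 2 n.+1 t = 0 by apply: SS0; lra.
have d : dS 2 n.+1 t = 0 by apply: dS0; lra.
have -> : gV n.+1 t = SS 2 n t * EE n.+1 t.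
  by rewrite /gV s EvE// subr0 mul1r.
have -> : dgV n.+1 t = (dS 2 n t + SS 2 n t * zz n.+1) * EE n.+1 t.
  by rewrite /dgV s d EvE// dthE// /CC /dC /= -/(SS 2 n t) -/(dS 2 n t); ring.
by rewrite EES.
Qed.

Lemma gWE n t : gW n t = (SS 0 n t - SS 4 n t) * (EE n t * expR (JJ n t * pp n)) /\
  dgW n t = (dS 0 n t - dS 4 n t + (SS 0 n t - SS 4 n t) *
    (zz n + 4 * (dS 1 n t - dS 3 n t) * pp n)) * (EE n t * expR (JJ n t * pp n)).
Proof. by rewrite /gW /dgW /Ew expRD; split => //; rewrite -/(EE n t); ring. Qed.

(** In the n-th strip only mode n, its auxiliary wave and mode n.+1 are alive. The free coefficients
    make one statement serve [uu] and all of its derivatives in the equation. *)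
Lemma glue_strip n t (ht : aa n.+1 < t <= aa n)
    (F : nat -> E3 -> R) (p : E3) (a b c d : nat -> R) : cT p = t ->
  (forall m, F m p = a m * gV m t + b m * dgV m t + (c m * gW m t + d m * dgW m t)) ->
  glue F p = a n * gV n t + b n * dgV n t + (c n * gW n t + d n * dgW n t) +
    (a n.+1 * gV n.+1 t + b n.+1 * dgV n.+1 t).
Proof.
move=> pt hF; have [t01 _ hlo hhi] := strip_lt ht.
have W m : m != n -> gW m t = 0 /\ dgW m t = 0.
  rewrite neq_ltn => /orP[h|h]; apply: gW_out; [right; exact: hlo|left; exact: hhi].
rewrite (@glue_eq _ _ _ _ n.+2) => [|m nm]; last first.
  rewrite hF; have [-> ->] : gW m t = 0 /\ dgW m t = 0 by apply: W; rewrite gtn_eqF// ltnW.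
  case: m nm => // m nm; have [-> ->] := @gV_out' m t (hhi m nm).
  by rewrite !mulr0 !addr0.
rewrite !big_ord_recr /= big1 ?add0r => [|i _]; last first.
  rewrite hF; have [-> ->] : gW i t = 0 /\ dgW i t = 0 by apply: W; rewrite ltn_eqF.
  have [-> ->] := @gV_out i t (hlo i (ltn_ord i)).
  by rewrite !mulr0 !addr0.
rewrite !hF; have [-> ->] : gW n.+1 t = 0 /\ dgW n.+1 t = 0 by apply: W; rewrite gtn_eqF.
by rewrite !mulr0 !addr0.
Qed.

(** This lemma and the next two are the absorption of the error by b_i and c, divided by [EE n]. The
    last hypothesis is the definition of the factor gamma, cleared of its denominator; the left side
    is a combination of the defects of the hypotheses. *)
Lemma first_switch (k c1 s1 c2 e S d H : R) : k != 0 -> c1 ^+ 2 + s1 ^+ 2 = 1 ->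
  H * (1 + e * e * (S * (c2 * c1))) = e * (d * c2) ->
  d * (e * e) * c2 - e * (H * s1 / k * (k * s1) + H * c1 * (c1 + S * (e * e) * c2)) = 0.
Proof.
move=> k0 cs hH.
transitivity (e * (e * (d * c2) - H * (1 + e * e * (S * (c2 * c1)))) +
  e * H * (1 - (c1 ^+ 2 + s1 ^+ 2))); first by field.
by rewrite hH cs !subrr !mulr0 addr0.
Qed.

Lemma second_switch (c1 c1' c2 s2 e X W S d H : R) : W * (e * e) = 1 ->
  c2 ^+ 2 + s2 ^+ 2 = 1 ->
  H * (1 + e * e * (((1 - S) * c1 + S * X * c1') * c2)) = e * (d * (X * c1' - c1)) ->
  d * (X * c1' - c1) - e * (H * s2 * s2 * W +
    H * c2 * ((1 - S) * c1 + S * X * c1' + W * c2)) = 0.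
Proof.
move=> hW cs hH.
transitivity (W * e * (e * (d * (X * c1' - c1)) -
    H * (1 + e * e * (((1 - S) * c1 + S * X * c1') * c2))) +
  (1 - W * (e * e)) * (d * (X * c1' - c1) - e * H * ((1 - S) * c1 + S * X * c1') * c2) +
  e * H * W * (1 - (c2 ^+ 2 + s2 ^+ 2))); first by ring.
by rewrite hH cs hW !subrr !mulr0 !mul0r !addr0.
Qed.

Lemma third_switch (k c1' s1' c2 e X Y W S d H : R) : k != 0 ->
  W = e * X * Y -> c1' ^+ 2 + s1' ^+ 2 = 1 ->
  H * (1 + e * ((1 - S) * Y * (c2 * c1'))) = - (d * Y * c2) ->
  - d * W * c2 - e * (H * s1' / k * (k * X * s1') +
    H * c1' * (X * c1' + (1 - S) * W * c2)) = 0.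
Proof.
move=> k0 -> cs hH.
transitivity (e * X * (- (d * Y * c2) - H * (1 + e * ((1 - S) * Y * (c2 * c1')))) +
  e * X * H * (1 - (c1' ^+ 2 + s1' ^+ 2))); first by field.
by rewrite hH cs !subrr !mulr0 addr0.
Qed.

(** At most one switch acts at a time. The second case covers both 5 * tau in [1, 2] and in [3, 4],
    where only the oscillation of l is at work. *)
Lemma switch_cases n t :
  [\/ [/\ dS 2 n t = 0, dS 4 n t = 0, SS 2 n t = 0, SS 4 n t = 0 & JJ n t = - 2],
      [/\ dS 0 n t = 0, dS 2 n t = 0 & dS 4 n t = 0],
      [/\ dS 0 n t = 0, dS 4 n t = 0, SS 0 n t = 1, SS 4 n t = 0 & JJ n t = 2]
    | [/\ dS 0 n t = 0, dS 2 n t = 0, SS 0 n t = 1, SS 2 n t = 1 & JJ n t = - 2]].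
Proof.
have [h1|h1] := leP (5 * tau n t) 1.
  apply: Or41; split; do ?[by apply: dS0; lra|by apply: SS0; lra].
  by rewrite /JJ !SS0 ?subrr ?mulr0 ?addr0//; lra.
have [h2|h2] := leP (5 * tau n t) 2.
  by apply: Or42; split; [apply: dS1|apply: dS0|apply: dS0]; lra.
have [h3|h3] := leP (5 * tau n t) 3.
  apply: Or43; split; do ?[by apply: dS0; lra|by apply: SS0; lra].
  - by apply: dS1; lra.
  - by apply: SS1; lra.
  - by rewrite /JJ SS1 ?SS0 ?subr0; lra.
have [h4|h4] := leP (5 * tau n t) 4.
  by apply: Or42; split; [apply: dS1|apply: dS1|apply: dS0]; lra.
apply: Or44; split; do ?[by apply: dS1; lra|by apply: SS1; lra].
by rewrite /JJ !SS1 ?subrr ?mulr0 ?addr0//; lra.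
Qed.

(** The equation on the n-th strip divided by [EE n], once the growth rates have cancelled against
    the second derivatives: what remains are the errors of the switches and the lower order
    terms. *)
Lemma switch_identity n p :
  dS 2 n (cT p) * (XX n (cT p) * cx' n p - cx n p) +
  (dS 0 n (cT p) - dS 4 n (cT p)) * expR (JJ n (cT p) * pp n) * cy n p -
  ep n * ((H1 n p * sx n p / kk n + H3 n p * sx' n p / kk n.+1) *
     (kk n * (1 - SS 2 n (cT p)) * sx n p + kk n.+1 * SS 2 n (cT p) * XX n (cT p) * sx' n p) +
   H2 n p * sy n p * sy n p * (SS 0 n (cT p) - SS 4 n (cT p)) * expR (JJ n (cT p) * pp n) +
   (H1 n p * cx n p + H2 n p * cy n p + H3 n p * cx' n p) *
     ((1 - SS 2 n (cT p)) * cx n p + SS 2 n (cT p) * XX n (cT p) * cx' n p +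
      (SS 0 n (cT p) - SS 4 n (cT p)) * expR (JJ n (cT p) * pp n) * cy n p)) = 0.
Proof.
set t := cT p.
have k0 : kk n != 0 by rewrite gt_eqF// kk_gt0.
have k0' : kk n.+1 != 0 by rewrite gt_eqF// kk_gt0.
have neq0 (x : R) : 1 / 2 <= x -> x != 0 by move=> h; rewrite gt_eqF//; lra.
have e1 : H1 n p * D1 n p = ep n * (dS 0 n t * cy n p).
  by rewrite /H1 divfK// neq0// D1_ge.
have e2 : H2 n p * D2 n p = ep n * (dS 2 n t * (XX n t * cx' n p - cx n p)).
  by rewrite /H2 divfK// neq0// D2_ge.
have e3 : H3 n p * D3 n p = - (dS 4 n t * YY n t * cy n p).
  by rewrite /H3 divfK// neq0// D3_ge.
have z1 : dS 0 n t = 0 -> H1 n p = 0 by rewrite /H1 -/t => ->; rewrite !(mul0r, mulr0).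
have z2 : dS 2 n t = 0 -> H2 n p = 0 by rewrite /H2 -/t => ->; rewrite !(mul0r, mulr0).
have z3 : dS 4 n t = 0 -> H3 n p = 0.
  by rewrite /H3 -/t => ->; rewrite !(mul0r, mulr0, oppr0).
have ce2 : expR (- 2 * pp n) = ep n * ep n.
  by rewrite /ep -expRD; congr expR; ring.
have cX2 : cx n p ^+ 2 + sx n p ^+ 2 = 1 by exact: cos2Dsin2.
have cX2' : cx' n p ^+ 2 + sx' n p ^+ 2 = 1 by exact: cos2Dsin2.
have cY2 : cy n p ^+ 2 + sy n p ^+ 2 = 1 by exact: cos2Dsin2.
case: (switch_cases n t) => [[d2 d4 s2 s4 j]|[d0 d2 d4]|[d0 d4 s0 s4 j]|[d0 d2 s0 s2 j]].
- rewrite (z2 d2) (z3 d4) j d2 d4 s2 s4 ce2.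
  move: e1; rewrite /D1 -/t => /(first_switch k0 cX2) e1.
  rewrite -[RHS]e1; move: (dS 0 n t) (SS 0 n t) (XX n t) (H1 n p) (ep n) => a b x h e.
  by move: (cx n p) (cx' n p) (cy n p) (sx n p) (sx' n p) (sy n p) (kk n) (kk n.+1) => *; ring.
- rewrite (z1 d0) (z2 d2) (z3 d4) d0 d2 d4.
  by rewrite !(mul0r, mulr0, addr0, subr0).
- have w : expR (2 * pp n) * (ep n * ep n) = 1.
    by rewrite -ce2 -expRD mulNr subrr expR0.
  rewrite (z1 d0) (z3 d4) j d0 d4 s0 s4.
  move: e2; rewrite /D2 -/t => /(second_switch w cY2) e2.
  rewrite -[RHS]e2; move: (dS 2 n t) (SS 2 n t) (XX n t) (H2 n p) (ep n) (expR _) => a b x h e u.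
  by move: (cx n p) (cx' n p) (cy n p) (sx n p) (sx' n p) (sy n p) (kk n) (kk n.+1) => *; ring.
have w : ep n * ep n = ep n * XX n t * YY n t.
  by rewrite -mulrA; congr (_ * _); rewrite /ep /XX /YY -expRD; congr expR; ring.
rewrite (z1 d0) (z2 d2) j d0 d2 s0 s2 ce2.
move: e3; rewrite /D3 -/t => /(third_switch k0' w cX2') e3.
rewrite -[RHS]e3; move: (dS 4 n t) (SS 4 n t) (XX n t) (H3 n p) (ep n) => a b x h e.
by move: (cx n p) (cx' n p) (cy n p) (sx n p) (sx' n p) (sy n p) (kk n) (kk n.+1) => *; ring.
Qed.

Let i0 : 'I_3 := @Ordinal 3 0 isT.
Let i1 : 'I_3 := @Ordinal 3 1 isT.
Let i2 : 'I_3 := @Ordinal 3 2 isT.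

Definition residual p : R :=
  'D_(et R) uu p + 'D_(ex1 R) ('D_(ex1 R) uu) p
  + ell (cT p) * 'D_(ex2 R) ('D_(ex2 R) uu) p
  + b1 p * 'D_(ex1 R) uu p + b2 p * 'D_(ex2 R) uu p + cc p * uu p.

(* Stated with abstract values, as rewriting would compare the various
   derivatives up to conversion. *)
Lemma residualE p vT vxx vyy vx vy v :
  glue (fun n => 'D_(et R) (UU n)) p = vT ->
  glue (fun n => 'D_(ex1 R) ('D_(ex1 R) (UU n))) p = vxx ->
  glue (fun n => 'D_(ex2 R) ('D_(ex2 R) (UU n))) p = vyy ->
  glue (fun n => 'D_(ex1 R) (UU n)) p = vx ->
  glue (fun n => 'D_(ex2 R) (UU n)) p = vy -> uu p = v ->
  residual p = vT + vxx + ell (cT p) * vyy + b1 p * vx + b2 p * vy + cc p * v.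
Proof.
move=> hT hxx hyy hx hy hu.
have E (a b c d e f a' b' c' d' e' f' l m n q : R) : a = a' -> b = b' -> c = c' ->
    d = d' -> e = e' -> f = f' ->
    a + b + l * c + m * d + n * e + q * f = a' + b' + l * c' + m * d' + n * e' + q * f'.
  by do 6!move=> ->.
exact: (E _ _ _ _ _ _ _ _ _ _ _ _ _ _ _ _ (etrans (uu_iter_derive [:: i0] p) hT)
  (etrans (uu_iter_derive [:: i1; i1] p) hxx) (etrans (uu_iter_derive [:: i2; i2] p) hyy)
  (etrans (uu_iter_derive [:: i1] p) hx) (etrans (uu_iter_derive [:: i2] p) hy) hu).
Qed.

Lemma uu_strip n p : aa n.+1 < cT p <= aa n -> uu p = EE n (cT p) *
  ((1 - SS 2 n (cT p)) * cx n p + SS 2 n (cT p) * XX n (cT p) * cx' n p +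
      (SS 0 n (cT p) - SS 4 n (cT p)) * expR (JJ n (cT p) * pp n) * cy n p).
Proof.
move=> ht; rewrite /uu (@glue_strip n (cT p) ht UU p (fun m => cx m p) (fun=> 0)
  (fun m => cy m p) (fun=> 0))//; last by move=> m; rewrite /UU /cx /cy; ring.
have [-> ->] := gV_strip ht; have [-> ->] := gVS_strip ht; have [-> ->] := gWE n (cT p).
rewrite -[cx n.+1 p]/(cx' n p); ring.
Qed.

(** The oscillating part of l cancels the derivative of [JJ], and what is left is [EE n] times the
    left side of [switch_identity]. *)
Lemma residual_strip n p : aa n.+1 < cT p <= aa n -> residual p = 0.
Proof.
move=> ht; have [t01 _ hlo hhi] := strip_lt ht.
have single (B : nat -> E3 -> R) :
    (forall m, tau m (cT p) <= 0 \/ 1 <= tau m (cT p) -> B m p = 0) ->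
    glue (fun n p => ep n * B n p) p = ep n * B n p.
  move=> hB; apply: glue_single => m; rewrite neq_ltn => /orP[h|h].
    by rewrite hB ?mulr0//; right; exact: hlo.
  by rewrite hB ?mulr0//; left; exact: hhi.
have eB1 : b1 p = ep n * B1 n p.
  by apply: single => m /HH_out[h1 h2 h3]; rewrite /B1 h1 h3 !mul0r addr0.
have eB2 : b2 p = ep n * B2 n p.
  by apply: single => m /HH_out[h1 h2 h3]; rewrite /B2 h2 !mul0r.
have eB3 : cc p = ep n * B3 n p.
  rewrite /cc single ?dthE ?subrr ?mulr0 ?addr0// => m /HH_out[h1 h2 h3].
  by rewrite /B3 h1 h2 h3 !mul0r !addr0 oppr0.
have eL : ell (cT p) = 1 + 4 * pp n / zz n * (dS 1 n (cT p) - dS 3 n (cT p)).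
  rewrite /ell (@glue_single _ _ _ n)// => m; rewrite neq_ltn => /orP[h|h].
    by apply: gl_out; right; exact: hlo.
  by apply: gl_out; left; exact: hhi.
have hT := @glue_strip n (cT p) ht (fun n => 'D_(et R) (UU n)) p
  (fun=> 0) (fun m => cx m p) (fun=> 0) (fun m => cy m p) erefl.
have hxx := @glue_strip n (cT p) ht (fun n => 'D_(ex1 R) ('D_(ex1 R) (UU n))) p
  (fun m => - (zz m * cx m p)) (fun=> 0) (fun=> 0) (fun=> 0) erefl.
have hyy := @glue_strip n (cT p) ht (fun n => 'D_(ex2 R) ('D_(ex2 R) (UU n))) p
  (fun=> 0) (fun=> 0) (fun m => - (zz m * cy m p)) (fun=> 0) erefl.
have hx := @glue_strip n (cT p) ht (fun n => 'D_(ex1 R) (UU n)) p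
  (fun m => - (kk m * sx m p)) (fun=> 0) (fun=> 0) (fun=> 0) erefl.
have hy := @glue_strip n (cT p) ht (fun n => 'D_(ex2 R) (UU n)) p
  (fun=> 0) (fun=> 0) (fun m => - (kk m * sy m p)) (fun=> 0) erefl.
rewrite (residualE (hT _) (hxx _) (hyy _) (hx _) (hy _) (uu_strip ht)); first last.
- by move=> m; rewrite UU_y; ring.
- by move=> m; rewrite UU_x; ring.
- by move=> m; rewrite UU_yy; ring.
- by move=> m; rewrite UU_xx; ring.
- by move=> m; rewrite UU_t; ring.
move=> {hT hxx hyy hx hy}.
have [-> ->] := gV_strip ht; have [-> ->] := gVS_strip ht; have [-> ->] := gWE n (cT p).
rewrite eL eB1 eB2 eB3 /B1 /B2 /B3.
rewrite -[cx n.+1 p]/(cx' n p) -[sx n.+1 p]/(sx' n p).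
have k0 : kk n != 0 by rewrite gt_eqF// kk_gt0.
have k0' : kk n.+1 != 0 by rewrite gt_eqF// kk_gt0.
have z0 : zz n != 0 by rewrite gt_eqF// zz_gt0.
transitivity (EE n (cT p) * 0); last by rewrite mulr0.
rewrite -[X in _ = _ * X](switch_identity n p).
move: (EE n (cT p)) (XX n (cT p)) (expR (JJ n (cT p) * pp n)) (SS 0 n (cT p)) (SS 2 n (cT p))
  (SS 4 n (cT p)) (dS 0 n (cT p)) (dS 1 n (cT p)) (dS 2 n (cT p))
  (dS 3 n (cT p)) (dS 4 n (cT p)) => E X W S0 S2 S4 d0 d1 d2 d3 d4.
move: (cx n p) (cx' n p) (cy n p) (sx n p) (sx' n p) (sy n p) (H1 n p) (H2 n p) (H3 n p)
  (ep n) (pp n) => c1 c1' c2 s1 s1' s2 h1 h2 h3 e P.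
move: k0 k0' z0; move: (kk n) (kk n.+1) (zz n) (zz n.+1) => k k' z z' k0 k0' z0.
by field; rewrite k0 k0' z0.
Qed.

Lemma UU_above p m : aa 0 < cT p -> gW m (cT p) = 0 /\ dgW m (cT p) = 0 /\
  gV m.+1 (cT p) = 0 /\ dgV m.+1 (cT p) = 0 /\
  gV 0 (cT p) = Ev 0 (cT p) /\ dgV 0 (cT p) = zz 0 * dth (cT p) * Ev 0 (cT p).
Proof.
move=> h; have t0 k : tau k (cT p) <= 0.
  by rewrite leNgt tau_gt0 -leNgt (le_trans (aa_le (leq0n k)))// ltW.
have [-> ->] := gW_out (or_introl (t0 m)); have [-> ->] := gV_out' (t0 m).
do 4!split => //.
have s : SS 2 0 (cT p) = 0 by apply: SS0; have := t0 0%N; lra.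
have d : dS 2 0 (cT p) = 0 by apply: dS0; have := t0 0%N; lra.
by rewrite /gV /dgV s d /CC /dC /= !mul0r add0r step_ge1//; split; ring.
Qed.

Lemma glue_above (F : nat -> E3 -> R) (p : E3) : (forall m, F m.+1 p = 0) -> glue F p = F 0%N p.
Proof. by move=> h; apply: glue_single; case. Qed.

Lemma uu_above p : aa 0 < cT p -> uu p = Ev 0 (cT p) * cx 0 p.
Proof.
move=> h; rewrite /uu glue_above => [|m]; rewrite /UU.
  by have [-> [_ [_ [_ [-> _]]]]] := UU_above 0 h; rewrite mul0r addr0.
have [_ [_ [-> _]]] := UU_above m h; have [-> _] := UU_above m.+1 h.
by rewrite !mul0r addr0.
Qed.

Lemma residual_above p : aa 0 < cT p -> residual p = 0.
Proof.
move=> h; have zero m : gW m (cT p) = 0 /\ dgW m (cT p) = 0 /\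
    gV m.+1 (cT p) = 0 /\ dgV m.+1 (cT p) = 0.
  by have [? [? [? []]]] := UU_above m h.
have H0 m : [/\ H1 m p = 0, H2 m p = 0 & H3 m p = 0].
  by apply: HH_out; left; rewrite leNgt tau_gt0 -leNgt (le_trans (aa_le (leq0n m)))// ltW.
have eB1 : b1 p = 0.
  rewrite /b1 glue_above => [|j]; rewrite /B1.
    by have [-> _ ->] := H0 0%N; rewrite !mul0r addr0 mulr0.
  by have [-> _ ->] := H0 j.+1; rewrite !mul0r addr0 mulr0.
have eB2 : b2 p = 0.
  rewrite /b2 glue_above => [|m]; rewrite /B2.
    by have [_ -> _] := H0 0%N; rewrite !mul0r mulr0.
  by have [_ -> _] := H0 m.+1; rewrite !mul0r mulr0.
have eB3 : cc p = zz 0 * (1 - dth (cT p)).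
  rewrite /cc glue_above => [|m]; rewrite /B3.
    by have [-> -> ->] := H0 0%N; rewrite !mul0r !addr0 oppr0 mulr0 add0r.
  by have [-> -> ->] := H0 m.+1; rewrite !mul0r !addr0 oppr0 mulr0.
have [w [w' [_ [_ [v v']]]]] := UU_above 0 h.
have hT : glue (fun n => 'D_(et R) (UU n)) p = zz 0 * dth (cT p) * Ev 0 (cT p) * cx 0 p.
  rewrite glue_above => [|m]; rewrite UU_t; first by rewrite v' w' mul0r addr0.
  by have [_ [_ [_ ->]]] := zero m; have [_ [-> _]] := zero m.+1; rewrite !mul0r addr0.
have hxx : glue (fun n => 'D_(ex1 R) ('D_(ex1 R) (UU n))) p = - (zz 0 * Ev 0 (cT p) * cx 0 p).
  rewrite glue_above => [|m]; rewrite UU_xx; first by rewrite v.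
  by have [_ [_ [-> _]]] := zero m; rewrite mulr0 mul0r oppr0.
have hyy : glue (fun n => 'D_(ex2 R) ('D_(ex2 R) (UU n))) p = 0.
  rewrite glue_above => [|m]; rewrite UU_yy; first by rewrite w mulr0 mul0r oppr0.
  by have [-> _] := zero m.+1; rewrite mulr0 mul0r oppr0.
rewrite (residualE hT hxx hyy erefl erefl (uu_above h)) eB1 eB2 eB3.
have E (z d v1 x a g g' : R) : z * d * v1 * x + - (z * v1 * x) + a * 0 + 0 * g + 0 * g' +
    z * (1 - d) * (v1 * x) = 0 by ring.
exact: E.
Qed.

Lemma residual_below p : cT p <= 0 -> residual p = 0.
Proof.
move=> h.
have z s : glue (fun n => iter_derive (axis R) s (UU n)) p = 0.
  exact: (glue_le0 (glueable_pd cT_continuous s glueable_UU)).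
rewrite (residualE (z [:: i0]) (z [:: i1; i1]) (z [:: i2; i2]) (z [:: i1]) (z [:: i2]) (z [::])).
by rewrite !mulr0 !addr0.
Qed.

Lemma residual0 p : residual p = 0.
Proof.
have [n [_ [[_ [h|h]]|h]]] := strip_pick (cT p).
- exact: residual_below.
- exact: residual_above.
- exact: residual_strip h.
Qed.

(** * The support *)

(** If cos (k x + s) and cos (k x - s) both equal cos (k x), for a small s with sin s > 0, then
    subtracting gives sin (k x) = 0, and then cos (k x) = 0 because cos s differs from 1. *)
Lemma cos_moves (k x eps : R) : 0 < k -> 0 < eps ->
  exists2 x', `|x' - x| < eps & cos (k * x') != cos (k * x).
Proof.
move=> k0 e0; pose s := Num.min (k * (eps / 2)) 1.
have s0 : 0 < s by rewrite lt_min ltr01 mulr_gt0// divr_gt0.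
have s1 : s <= 1 by rewrite ge_min lexx orbT.
have se : s <= k * (eps / 2) by rewrite ge_min lexx.
have ss : 0 < sin s.
  by apply: sin_gt0_pi; rewrite s0 /=; apply: le_lt_trans s1 _; have := pi_ge2 R; lra.
have near1 (y : R) : `|y| = s -> `|x + y / k - x| < eps.
  move=> ys; rewrite addrAC subrr add0r normrM normfV (gtr0_norm k0) ys ltr_pdivrMr//.
  apply: le_lt_trans se _; rewrite mulrC ltr_pM2r//; lra.
have kx y : k * (x + y / k) = k * x + y by rewrite mulrDr mulrCA mulfV ?mulr1// gt_eqF.
have [c1|c1] := eqVneq (cos (k * x + s)) (cos (k * x)); last first.
  by exists (x + s / k); rewrite ?kx// near1// gtr0_norm.
have [c2|c2] := eqVneq (cos (k * x - s)) (cos (k * x)); last first.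
  by exists (x + - s / k); rewrite ?kx// near1// normrN gtr0_norm.
exfalso; move: c1 c2; rewrite cosD cosB => c1 c2.
have a : sin (k * x) = 0.
  apply/eqP; have : sin (k * x) * sin s = 0 by lra.
  by move/eqP; rewrite mulf_eq0 (gt_eqF ss) orbF.
have b : cos s != 1.
  apply/eqP => cs; have := cos2Dsin2 s; rewrite cs expr1n => h.
  have : sin s ^+ 2 = 0 by lra.
  by move/eqP; rewrite sqrf_eq0 gt_eqF.
have c : cos (k * x) = 0.
  move: c1; rewrite a mul0r subr0 => c1; apply/eqP.
  have : cos (k * x) * (cos s - 1) = 0 by rewrite mulrBr c1 mulr1 subrr.
  by move/eqP; rewrite mulf_eq0 subr_eq0 (negbTE b) orbF.
by have := cos2Dsin2 (k * x); rewrite a c expr0n /= addr0 => /eqP; rewrite eq_sym oner_eq0.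
Qed.

(** In a strip below its upper end the auxiliary wave is present at every time, so [uu] is affine in
    cos (k y) with a nonzero slope, and moving y suffices. At t = aa n, and above aa 0, a single
    mode is alive, and x is moved instead. *)
Lemma uu_dense t x y eps : 0 < t -> 0 < eps ->
  exists x' y', [/\ `|x' - x| < eps, `|y' - y| < eps & uu (t, (x', y')) != 0].
Proof.
move=> t0 e0.
have self z : `|z - z| < eps by rewrite subrr normr0.
have varx (g k : R) : 0 < g -> 0 < k ->
    (forall x', uu (t, (x', y)) = g * cos (k * x')) ->
    exists x' y', [/\ `|x' - x| < eps, `|y' - y| < eps & uu (t, (x', y')) != 0].
  move=> g0 k0 hu; have [x' hx' cne] := cos_moves x k0 e0.
  have [c0|c0] := eqVneq (cos (k * x)) 0.
    by exists x', y; split => //; rewrite hu mulf_neq0//; [rewrite gt_eqF|rewrite -c0].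
  by exists x, y; split => //; rewrite hu mulf_neq0// gt_eqF.
have [n [_ [[_ [h|h]]|h]]] := strip_pick t.
- by move: t0; rewrite ltNge h.
- apply: (varx (Ev 0 t) (kk 0)); [exact: expR_gt0|exact: kk_gt0|].
  by move=> x'; rewrite uu_above.
have [_ /andP[h0 h1] _ _] := strip_lt h.
have E0 : 0 < EE n t by exact: expR_gt0.
move: h0; rewrite le_eqVlt => /orP[/eqP h0|h0].
  apply: (varx (EE n t) (kk n)) => //; first exact: kk_gt0.
  have s j : SS j n t = 0 by apply: SS0; rewrite -h0 mulr0.
  move=> x'; rewrite (@uu_strip n (t, (x', y)) h) -![cT _]/t !s -[cx _ _]/(cos (kk n * x')).
  by rewrite !mul0r subrr subr0 mul1r !mul0r !addr0.
have B0 : SS 0 n t - SS 4 n t != 0.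
  rewrite gt_eqF// subr_gt0; have [h4|h4] := leP (5 * tau n t) 4.
    by rewrite (SS0 (j := 4))// /SS argE; apply: step_gt0; lra.
  rewrite [ltRHS]SS1; last by lra.
  by rewrite /SS argE; apply: step_lt1; lra.
have [y' hy' cne] := cos_moves y (kk_gt0 n) e0.
have [u0|u0] := eqVneq (uu (t, (x, y))) 0; last by exists x, y.
exists x, y'; split => //; apply/eqP => u1; move/eqP: cne; apply.
move: u0 u1; rewrite (@uu_strip n (t, (x, y)) h) (@uu_strip n (t, (x, y')) h).
rewrite -![cT _]/t -![cx n _]/(cos (kk n * x)) -![cx' n _]/(cos (kk n.+1 * x)).
rewrite -[cy n (t, (x, y))]/(cos (kk n * y)) -[cy n (t, (x, y'))]/(cos (kk n * y')).
move=> /eqP; rewrite mulf_eq0 (gt_eqF E0) /= => /eqP u0.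
move=> /eqP; rewrite mulf_eq0 (gt_eqF E0) /= => /eqP; rewrite -u0 => /addrI.
by move/mulfI; apply; rewrite mulf_neq0// gt_eqF// expR_gt0.
Qed.

Lemma Supp_uu : Supp uu = [set p : E3 | 0 <= p.1].
Proof.
apply/seteqP; split.
- have h : closed [set p : E3 | 0 <= p.1] := closed_ge_cT (c := 0).
  rewrite [X in _ `<=` X](closure_id _).1//.
  apply: closure_subset => p /= up; rewrite leNgt; apply/negP => /ltW h0.
  by move/eqP: up; apply; exact: (glue_le0 glueable_UU).
- move=> [t [x y]] /= t0 B /nbhs_ballP[e /= e0 he].
  have e2 : 0 < e / 2 by rewrite divr_gt0.
  (* Moving the time up by e / 2 makes it positive, which also reaches the boundary points t = 0. *)
  have [|x' [y' [hx hy hu]]] := @uu_dense (t + e / 2) x y e _ e0.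
    by rewrite ltr_wpDl.
  exists (t + e / 2, (x', y')); split => //; apply: he.
  have bR (a b : R) : `|b - a| < e -> ball a e b by rewrite -ball_normE /= distrC.
  split; first by apply: bR; rewrite /= addrAC subrr add0r gtr0_norm//; lra.
  by split; apply: bR.
Qed.

End Construction.

Theorem theorem3 (R : realType) :
  exists l : R -> R,
    [/\ forall alpha : R, 0 <= alpha < 1 -> C0_alpha alpha l,
        smooth_on [set t : R | t != 0] l,
        forall t : R, 1 / 2 <= l t <= 3 / 2,
        forall eps : R, 0 < eps -> exists C : R, forall t : R, t != 0 ->
          `|derive1 l t| <= C * `|t| `^ (- (1 + eps))
      & exists u b1 b2 c : R * (R * R) -> R,
        [/\ [/\ Cb_infty u, Cb_infty b1, Cb_infty b2 & Cb_infty c],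
            Supp u = [set p : R * (R * R) | 0 <= p.1]
          & forall p : R * (R * R),
              'D_(et R) u p + 'D_(ex1 R) ('D_(ex1 R) u) p
              + l p.1 * 'D_(ex2 R) ('D_(ex2 R) u) p
              + b1 p * 'D_(ex1 R) u p + b2 p * 'D_(ex2 R) u p
              + c p * u p = 0]].
Proof.
have [B hB] := @dstep_bounded R.
(* 30 gives [dl] <= 1/2, and the other bound keeps l within 1/2 of 1. *)
pose n0 := maxn 30 (Num.Def.truncn (1200 * B)).+1.
have n0_ge : (30 <= n0)%N by exact: leq_maxl.
have Bn : 1200 * B <= n0%:R.
  apply/ltW; apply: lt_le_trans (truncnS_gt _) _.
  by rewrite ler_nat; exact: leq_maxr.
exists (@ell R n0); split.
- by move=> al; exact: (ell_C0_alpha n0_ge hB Bn).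
- exact: ell_smooth.
- by move=> t; exact: (ell_bounds n0_ge t hB Bn).
- exact: ell_derive_bound.
exists (@uu R n0), (@b1 R n0), (@b2 R n0), (@cc R n0); split.
- by split; [exact: Cb_uu|exact: Cb_b1|exact: Cb_b2|exact: Cb_cc].
- exact: Supp_uu.
- by move=> p; exact: (residual0 n0_ge p).
Qed.
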